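(* Let $\pi=\{-,-\}$ be a $\mathbb{Z}^n$-graded Loday structure on a $\mathbb{Z}^n$-graded vector space $V$. The graded Loday cohomology operator $\partial_\pi$ reads, for any $B\in M^{(B,b)}(V)$, $b\ge-1$, and any homogeneous $v_1,\ldots,v_{b+2}\in V$, $$(\partial_\pi B)(v_1,\ldots,v_{b+2})=(-1)^{b+1}\{B(v_1,\ldots,v_{b+1}),v_{b+2}\}$$ $$-\sum_{i=1}^{b+1}(-1)^{i-1}(-1)^{\langle B+v_1+\ldots+v_{i-1},v_i\rangle}\{v_i,B(v_1,\ldots,\widehat{v_i},\ldots,v_{b+1},v_{b+2})\}$$ $$+\sum_{i=1}^{b+1}\sum_{j=1}^i(-1)^{j+1}(-1)^{\langle v_j,v_{j+1}+\ldots+v_i\rangle}B(v_1,\ldots,\widehat{v_j},\ldots,v_i,\{v_j,v_{i+1}\},v_{i+2},\ldots,v_{b+2}).$$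
   Context: Vector spaces are over a field $\mathbb{K}$ of characteristic $0$; for $\alpha,\beta\in\mathbb{Z}^m$, $\langle\alpha,\beta\rangle=\sum_i\alpha_i\beta_i$. A homogeneous vector or map and its degree/weight are denoted by the same symbol; $e_1=(1,0,\ldots,0)\in\mathbb{Z}^n$. A hat means omission. A $\mathbb{Z}^n$-graded Loday structure on $V$ is a weight $0$ bilinear bracket with $\{a,\{b,c\}\}=\{\{a,b\},c\}+(-1)^{\langle a,b\rangle}\{b,\{a,c\}\}$ for homogeneous $a,b,c$. $M^{(A,-1)}(V)=V^A$, and $M^{(A,a)}(V)$, $a\ge0$, is the space of $(a+1)$-linear maps $V^{\times(a+1)}\to V$ of weight $A\in\mathbb{Z}^n$. The operator $\partial_\pi$ is defined on $M^{(B,b)}(V)$, $b\ge0$, by $\partial_\pi B=[\pi,B]^\otimes$, where $[-,-]^\otimes$ is the stem bracket, and extended to $v\in V=\bigoplus_A M^{(A,-1)}(V)$ by $(\partial_\pi v)(w):=\pi(v,w)=\{v,w\}$, $w\in V$. Tensor coalgebra. For a graded space $W$, $T(W)=\bigoplus_{p\ge1}W^{\otimes p}$, $\mathbb{Z}^n$-graded by total degree, with coproduct $\Delta(w_1\otimes\ldots\otimes w_p)=\sum_{I\cup J=N^{(p-1)},\,I\ne\emptyset}\varepsilon_W(I;J)W_I\bigotimes W_J\otimes w_p$. Here $N^{(p)}=(1,\ldots,p)$, $I,J$ are disjoint naturally ordered subsets with the given union, $W_I=w_{i_1}\otimes\ldots\otimes w_{i_{|I|}}$, and $\varepsilon_W(I;J)$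 is the Koszul sign of the rearrangement of $(W_I,W_J)$ into increasing index order. Tensor products of maps: $(f\otimes g)(v_1\otimes v_2)=(-1)^{\langle g,v_1\rangle}f(v_1)\otimes g(v_2)$. A weight $Q$ coderivation is a weight $Q$ linear map with $\Delta Q=(Q\otimes\mathrm{id}+\mathrm{id}\otimes Q)\Delta$. The graded commutator is $[Q,Q']=QQ'-(-1)^{\langle Q,Q'\rangle}Q'Q$. A weight $Q$ coderivation is uniquely determined by its corestrictions $Q_p:W^{\otimes p}\hookrightarrow T(W)\xrightarrow{Q}T(W)\to W$, which can be arbitrary weight $Q$ maps, via $$Q(w_1\otimes\ldots\otimes w_p)=\sum_{I\cup J\cup K=N^{(p)},\;I,J<K}\varepsilon_W(I;J)(-1)^{\langle Q,W_I\rangle}W_I\otimes Q_{|J|+1}(W_J\otimes w_{k_1})\otimes W_{K\setminus k_1},$$ with $I,J$ possibly empty, $K=(k_1<k_2<\ldots)$ nonempty, and $I<K$ meaning that the last element of $I$ is smaller than $k_1$. Desuspension and stem bracket. $\downarrow V$ is $V$ with grading $(\downarrow V)^\alpha=V^{\alpha+e_1}$; $\downarrow:V\to\downarrow V$ has weight $-e_1$ and inverse $\uparrow$; $\uparrow^{\otimes p}=\uparrow\otimes\ldots\otimes\uparrow$ with the sign convention $(f\otimes g)(v_1\otimes v_2)=(-1)^{\langle g,v_1\rangle}f(v_1)\otimes g(v_2)$ for tensor products of maps. For $A\in M^{(A,a)}(V)$, $a\ge0$, $\phi_{(A,a)}(A)$ is the weight $A+ae_1$ coderivation of $T(\downarrow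 V)$ whose only (possibly) nonzero corestriction is $(-1)^{\frac{a(a+1)}{2}}\downarrow\circ A\circ\uparrow^{\otimes(a+1)}$. The stem bracket of $A\in M^{(A,a)}(V)$, $B\in M^{(B,b)}(V)$, $a,b\ge0$, is $[A,B]^\otimes:=(-1)^{1+\langle ae_1,be_1+B\rangle}\phi^{-1}_{(A+B,a+b)}([\phi_{(A,a)}(A),\phi_{(B,b)}(B)])\in M^{(A+B,a+b)}(V)$. *)

(* Defs.v *)
From HB Require Import structures.
From mathcomp Require Import all_boot all_order all_algebra.
From mathcomp Require Import boolp freeg.
From mathcomp Require classical_sets.

Set Implicit Arguments.
Unset Strict Implicit.
Unset Printing Implicit Defensive.

Import GRing.Theory.
Local Open Scope ring_scope.
Local Open Scope quotient_scope.

(* xget x0 P is an element satisfying P, or x0 if there is none. It is used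
   below for maps specified by their values on homogeneous elements, or by their
   corestrictions: these are unique, and exist for the inputs of interest. *)
Notation xget := classical_sets.xget.

Section LinearQuotient.
Variables (K : fieldType) (M : lmodType K) (R : M -> Prop).

Inductive lspan : M -> Prop :=
| lspan0 : lspan 0
| lspanD c u v : R u -> lspan v -> lspan (c *: u + v).

Lemma lspan_lin c u v : lspan u -> lspan v -> lspan (c *: u + v).
Proof.
elim=> [|e u1 u2 Ru1 _ IH] Sv; first by rewrite scaler0 add0r.
by rewrite scalerDr scalerA -addrA; apply: lspanD => //; apply: IH.
Qed.

Definition in_lspan : {pred M} := fun x => `[< lspan x >].

Lemma in_lspan_zmod_closed : zmod_closed in_lspan.
Proof.
split; first exact/asboolP/lspan0.
move=> u v /asboolP Su /asboolP Sv; apply/asboolP.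
by rewrite addrC -scaleN1r; apply: lspan_lin.
Qed.
HB.instance Definition _ := GRing.isZmodClosed.Build M in_lspan
  in_lspan_zmod_closed.

(* M / <R> *)
Definition lquot := Quotient.quot in_lspan.
HB.instance Definition _ := GRing.Zmodule.on lquot.
HB.instance Definition _ := EqQuotient.on lquot.

Definition lquot_scale (c : K) (x : lquot) : lquot := \pi_lquot (c *: repr x).

Lemma lquot_scale_pi c (u : M) : lquot_scale c (\pi_lquot u) = \pi_lquot (c *: u).
Proof.
have Su : repr (\pi_lquot u) - u \in in_lspan.
  by rewrite Quotient.idealrBE reprK.
apply/eqP; rewrite /lquot_scale -Quotient.idealrBE -scalerBr.
move/asboolP: Su => Su; apply/asboolP.
by rewrite -[_ *: _]addr0; apply: lspan_lin Su lspan0.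
Qed.

Let piD (u v : M) : \pi_lquot (u + v) = \pi_lquot u + \pi_lquot v.
Proof. exact: (@Quotient.pi_add M in_lspan u v). Qed.

Let piW (P : lquot -> Prop) : (forall u : M, P (\pi_lquot u)) -> forall x, P x.
Proof. by move=> Ppi x; rewrite -[x]reprK; apply: Ppi. Qed.

Fact lquot_scaleA a b (x : lquot) :
  lquot_scale a (lquot_scale b x) = lquot_scale (a * b) x.
Proof. by move: x; apply: piW => u; rewrite !lquot_scale_pi scalerA. Qed.

Fact lquot_scale1 : left_id 1 lquot_scale.
Proof. by apply: piW => u; rewrite lquot_scale_pi scale1r. Qed.

Fact lquot_scaleDr : right_distributive lquot_scale +%R.
Proof.
move=> c; apply: piW => u; apply: piW => v.
by rewrite -piD !lquot_scale_pi scalerDr piD.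
Qed.

Fact lquot_scaleDl (x : lquot) : {morph lquot_scale^~ x : a b / a + b}.
Proof. by move: x; apply: piW => u a b; rewrite !lquot_scale_pi scalerDl piD. Qed.

HB.instance Definition _ := GRing.Zmodule_isLmodule.Build K lquot
  lquot_scaleA lquot_scale1 lquot_scaleDr lquot_scaleDl.
End LinearQuotient.

Section Tensor.
Variables (K : fieldType) (U W : lmodType K).

Inductive tensor_rel : {freeg (U * W)%type / K} -> Prop :=
| TensorL c u1 u2 w :
    tensor_rel (<< (c *: u1 + u2, w) >> - c *: << (u1, w) >> - << (u2, w) >>)
| TensorR c u w1 w2 :
    tensor_rel (<< (u, c *: w1 + w2) >> - c *: << (u, w1) >> - << (u, w2) >>).

Definition tensor : lmodType K := lquot tensor_rel.
Definition tpair (u : U) (w : W) : tensor := \pi_(lquot tensor_rel) << (u, w) >>.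
End Tensor.

(* All tensor powers at once: words modulo multilinearity in each letter (these
   relations preserve the length), the empty word being killed. *)
Section TensorPowers.
Variables (K : fieldType) (W : lmodType K).

Inductive word_rel : {freeg (seq W) / K} -> Prop :=
| WordNil : word_rel << [::] >>
| WordLin s t c x y :
    word_rel (<< s ++ (c *: x + y) :: t >>
              - c *: << s ++ x :: t >> - << s ++ y :: t >>).

Definition tpowers : lmodType K := lquot word_rel.

(* w_1 (x) ... (x) w_p, for p >= 1 *)
Definition word (s : seq W) : tpowers := \pi_(lquot word_rel) << s >>.

(* The projection of T(W) onto W^{(x) 1} = W. *)
Definition proj1T : tpowers -> W :=
  xget (fun=> 0) (fun p : tpowers -> W =>
    [/\ linear p, forall w, p (word [:: w]) = w
      & forall s, size s != 1%N -> p (word s) = 0]).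
End TensorPowers.

Definition weight (n : nat) := 'rV[int]_n.

Definition dot n (d e : weight n) : int := \sum_(i < n) d 0 i * e 0 i.

Definition e1 n : weight n := \row_(i < n) ((i == 0%N :> nat)%:Z).

(* (-1)^<d, e>, as a scalar *)
Definition sg (K : fieldType) n (d e : weight n) : K := (-1) ^ (dot d e).

Record gradedSpace (K : fieldType) (n : nat) := GradedSpace {
  gcar :> lmodType K;
  homog : weight n -> gcar -> Prop;
  homog0 : forall d, homog d 0;
  homogP : forall d c x y, homog d x -> homog d y -> homog d (c *: x + y);
  homog_sum : forall x, exists (s : seq (weight n)) (f : weight n -> gcar),
    (forall d, homog d (f d)) /\ x = \sum_(d <- s) f d;
  homog_direct : forall (s : seq (weight n)) (f : weight n -> gcar),
    uniq s -> (forall d, homog d (f d)) -> \sum_(d <- s) f d = 0 ->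
    forall d, d \in s -> f d = 0
}.

Section Graded.
Variables (K : fieldType) (n : nat).
Implicit Types (V W : gradedSpace K n) (d q dA dB dC : weight n).

Definition homogs W p (d : p.-tuple (weight n)) (w : p.-tuple W) :=
  forall i, homog (tnth d i) (tnth w i).

Definition hom_down V d (x : V) := homog (d + e1 n) x.

Fact hom_down_sum V (x : V) : exists (s : seq (weight n)) (f : weight n -> V),
  (forall d, hom_down d (f d)) /\ x = \sum_(d <- s) f d.
Proof.
have [s [f [hf ->]]] := homog_sum x.
exists [seq d - e1 n | d <- s], (fun d => f (d + e1 n)).
split=> [d|]; first exact: hf.
by rewrite big_map; apply: eq_bigr => d _; rewrite subrK.
Qed.

Fact hom_down_direct V (s : seq (weight n)) (f : weight n -> V) :
  uniq s -> (forall d, hom_down d (f d)) -> \sum_(d <- s) f d = 0 ->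
  forall d, d \in s -> f d = 0.
Proof.
move=> us hf s0 d ds.
have inj : injective (fun d => d + e1 n) by apply: addIr.
rewrite -[d](addrK (e1 n)).
apply: (@homog_direct _ _ V [seq d + e1 n | d <- s] (fun d => f (d - e1 n))).
- by rewrite map_inj_uniq.
- by move=> e; have := hf (e - e1 n); rewrite /hom_down subrK.
- by rewrite big_map -[RHS]s0; apply: eq_bigr => e _; rewrite addrK.
- exact: (map_f (fun d => d + e1 n) ds).
Qed.

Definition down V : gradedSpace K n :=
  @GradedSpace K n V (@hom_down V) (fun d => homog0 V (d + e1 n))
    (fun d => @homogP _ _ V (d + e1 n)) (@hom_down_sum V) (@hom_down_direct V).

Definition to_down V (x : V) : down V := x.
Definition to_up V (x : down V) : V := x.

Definition T W : lmodType K := tpowers W.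

(* The elements of T(W) of total degree d. *)
Definition homogT W d : T W -> Prop :=
  lspan (fun x => exists p (w : p.+1.-tuple W) (dw : p.+1.-tuple (weight n)),
    [/\ homogs dw w, \sum_(i < p.+1) tnth dw i = d & x = word w]).

(* The sign of w_I (x) w_J |-> w_{I u J}, for letters of degrees d. *)
Definition koszul p (d : p.-tuple (weight n)) (I J : {set 'I_p}) : K :=
  \prod_(i in I) \prod_(j in J | (j < i)%N) sg K (tnth d i) (tnth d j).

Definition subword W p (w : p.-tuple W) (I : {set 'I_p}) : seq W :=
  [seq tnth w i | i in I].

(* ord_max is the index of the last letter, so that [set~ ord_max] plays the
   role of N^(p-1). *)
Definition coproduct W : T W -> tensor (T W) (T W) :=
  xget (fun=> 0) (fun D : T W -> tensor (T W) (T W) =>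
    linear D /\
    forall p (w : p.+1.-tuple W) (d : p.+1.-tuple (weight n)), homogs d w ->
      D (word w) =
      \sum_(I : {set 'I_p.+1} | (I != set0) && (I \subset [set~ ord_max]))
        koszul d I ([set~ ord_max] :\: I) *:
          tpair (word (subword w I))
                (word (rcons (subword w ([set~ ord_max] :\: I))
                             (tnth w ord_max)))).

(* f (x) g, for g of weight dg *)
Definition tensor_map W (f : T W -> T W) dg (g : T W -> T W) :
    tensor (T W) (T W) -> tensor (T W) (T W) :=
  xget (fun=> 0) (fun F : tensor (T W) (T W) -> tensor (T W) (T W) =>
    linear F /\
    forall d x y, homogT d x ->
      F (tpair x y) = sg K dg d *: tpair (f x) (g y)).

Definition coderivation W q (Q : T W -> T W) :=
  [/\ linear Q,
      forall d x, homogT d x -> homogT (d + q) (Q x)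
    & forall x, coproduct (Q x) =
        tensor_map Q 0 id (coproduct x) + tensor_map id q Q (coproduct x)].

Definition commutator W q (Q : T W -> T W) q' (Q' : T W -> T W) : T W -> T W :=
  fun x => Q (Q' x) - sg K q q' *: Q' (Q x).

Definition set_tnth (X : Type) p (t : p.-tuple X) (i : 'I_p) (x : X) :
  p.-tuple X := [tuple if j == i then x else tnth t j | j < p].

(* M^{(dA, a)}(V), with m = a + 1 the number of arguments. For m = 0, a map on
   the one-point set V^0 is identified with its value, a vector of V^dA. *)
Definition cochain V m dA (A : m.-tuple V -> V) :=
  (forall (t : m.-tuple V) (i : 'I_m) c x y,
     A (set_tnth t i (c *: x + y)) =
     c *: A (set_tnth t i x) + A (set_tnth t i y)) /\
  (forall (t : m.-tuple V) (d : m.-tuple (weight n)), homogs d t ->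
     homog (dA + \sum_(i < m) tnth d i) (A t)).

(* The sign of up^{(x) p} on x_1 (x) ... (x) x_p, where d lists the degrees of
   the x_i in down V: up^{(x)(p-1)}, of weight (p-1) e1, moves past x_1. *)
Fixpoint up_sign (d : seq (weight n)) : K :=
  if d is d1 :: d' then sg K (e1 n *+ size d') d1 * up_sign d' else 1.

(* phi_{(dA, a)}(A) *)
Definition phi V dA a (A : a.+1.-tuple V -> V) : T (down V) -> T (down V) :=
  xget (fun=> 0) (fun Q : T (down V) -> T (down V) =>
    [/\ coderivation (dA + e1 n *+ a) Q,
        forall (w : a.+1.-tuple (down V)) (d : a.+1.-tuple (weight n)),
          homogs d w ->
          proj1T (Q (word w)) =
          ((-1) ^+ (a * a.+1)./2 * up_sign d) *:
            to_down (A (map_tuple (@to_up V) w))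
      & forall p (w : p.-tuple (down V)), p != a.+1 ->
          proj1T (Q (word w)) = 0]).

(* phi_{(dC, c)}^{-1}(Q) *)
Definition phi_inv V dC c (Q : T (down V) -> T (down V)) :
    c.+1.-tuple V -> V :=
  xget (fun=> 0) (fun C : c.+1.-tuple V -> V =>
    cochain dC C /\ phi dC C = Q).

Definition stem_bracket V dA a (A : a.+1.-tuple V -> V)
    dB b (B : b.+1.-tuple V -> V) : (a + b).+1.-tuple V -> V :=
  fun v => (- sg K (e1 n *+ a) (e1 n *+ b + dB)) *:
    phi_inv (dA + dB) (commutator (dA + e1 n *+ a) (phi dA A)
                                  (dB + e1 n *+ b) (phi dB B)) v.

Definition bilin V (br : V -> V -> V) : 2.-tuple V -> V :=
  fun t => br (tnth t 0) (tnth t 1).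

Definition loday V (br : V -> V -> V) :=
  cochain 0 (bilin br) /\
  forall da db dc a b c, homog da a -> homog db b -> homog dc c ->
    br a (br b c) = br (br a b) c + sg K da db *: br b (br a c).

(* The operator on M^{(dB, m - 1)}(V). *)
Definition loday_diff V (br : V -> V -> V) dB m :
    (m.-tuple V -> V) -> m.+1.-tuple V -> V :=
  match m with
  | 0 => fun B v => br (B [tuple]) (thead v)
  | b.+1 => fun B => stem_bracket 0 (bilin br) dB B
  end.

(* B(s_1, ..., s_m), meant for lists s of length m *)
Definition eval_seq V m (B : m.-tuple V -> V) (s : seq V) : V :=
  B [tuple nth 0 s k | k < m].

End Graded.

Arguments loday_diff {K n V} br dB {m} B v.

(* Main.v *)
Require Import Defs.
From HB Require Import structures.
From mathcomp Require Import all_boot all_order all_algebra.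
From mathcomp Require Import boolp ring zify.
From mathcomp Require freeg.

Set Implicit Arguments.
Unset Strict Implicit.
Unset Printing Implicit Defensive.

Import GRing.Theory.
Local Open Scope ring_scope.

(** Let B have b + 1 >= 1 arguments.  Up to a sign, the value of the stem bracket
    of the structure br and B on v_1, ..., v_(b+2) is the corestriction, on the
    word v_1 (x) ... (x) v_(b+2) of the desuspended letters, of the graded
    commutator of the coderivations phi(br) and phi(B).

    A term of a coderivation picks letters to be fed to the corestriction,
    the last of which marks the place of the result; the earlier letters that
    are left over come first, and the later ones follow the result.
    - When phi(B) acts first, b + 1 of the b + 2 letters enter B and br receives
      the result and the remaining letter: this letter is either the last one,
      and the term is {B(v_1, ..., v_(b+1)), v_(b+2)}, or some v_i with
      i <= b + 1, which comes first, and the term is {v_i, B(...)}.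
    - When phi(br) acts first, two letters v_j and v_(i+1), with j <= i, are
      replaced by {v_j, v_(i+1)} at the place of v_(i+1), and the b + 1 resulting
      letters all enter B.
    These are the three sums of the formula ([br_after_B_expand] and
    [B_after_br_expand]).  The signs are products of values of the bicharacter
    (-1)^<a, b>, and they agree because the exponents have the same parity
    ([sign_last], [sign_middle], [sign_bracket]).

    The coproduct, phi and its inverse are characterized by properties, so most
    of the work is to prove existence and uniqueness.
    - Formulas with Koszul signs only make sense on homogeneous letters.  A
      function of lists of letters paired with degrees, linear in each letter,
      determines a linear map on T(W): sum over the homogeneous components of the
      letters ([T_lift], [T_eq]).
    - For the coproduct and for coderivations, the dual operators on functions of
      words are used: [unshuffle F] sums the values of F over the terms of the
      coproduct, and [coextend f] those of f over the terms of a coderivation.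
      Both obey a recursion on the first letter, so that the co-Leibniz rule
      becomes an identity between functions of lists, proved by induction without
      any linear structure on the words ([coextend_unshuffle]).
    - An element x of T(W) is recovered from its projection to W and its
      coproduct: for a word of length at least two, exactly one term u (x) v of its
      coproduct has a v of length one, and the concatenation of u and v is the
      word ([append_ex]).  By induction on the length, a coderivation is determined
      by its corestrictions ([coderivation_unique]).  Hence phi(A) is the explicit
      coderivation ([phi_spec]), and a commutator, being a coderivation, is phi of
      the map read off from its corestriction ([phi_inv_spec]). *)

(** * Linear maps out of quotients, tensor powers and tensor products *)

Section Lifting.
Import freeg.
Local Open Scope quotient_scope.
Variable K : fieldType.

Lemma linear_sub (M N : lmodType K) (f : M -> N) :
  linear f -> {morph f : x y / x - y}.
Proof. by move=> lf x y; rewrite addrC -scaleN1r lf scaleN1r addrC. Qed.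

Lemma linear_zero (M N : lmodType K) (f : M -> N) : linear f -> f 0 = 0.
Proof. by move=> lf; rewrite -(subrr 0) (linear_sub lf) subrr. Qed.

Lemma linear_scale (M N : lmodType K) (f : M -> N) c x :
  linear f -> f (c *: x) = c *: f x.
Proof. by move=> lf; rewrite -[c *: x]addr0 lf (linear_zero lf) addr0. Qed.

Lemma linear_add (M N : lmodType K) (f : M -> N) x y :
  linear f -> f (x + y) = f x + f y.
Proof. by move=> lf; rewrite -[x]scale1r lf !scale1r. Qed.

Lemma linear_sumE (M N : lmodType K) (f : M -> N) I (r : seq I) P (F : I -> M) :
  linear f -> f (\sum_(i <- r | P i) F i) = \sum_(i <- r | P i) f (F i).
Proof.
move=> lf; elim/big_rec2: _ => [|i x y _ <-]; first exact: linear_zero.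
exact: linear_add.
Qed.

Lemma lquot_pi_eq0 (M : lmodType K) (R : M -> Prop) u v :
  lspan R (u - v) -> \pi_(lquot R) u = \pi_(lquot R) v.
Proof.
move=> Ruv; apply/eqP; rewrite -Quotient.idealrBE; exact/asboolP.
Qed.

Lemma lquot_pi_lin (M : lmodType K) (R : M -> Prop) :
  linear (fun u => \pi_(lquot R) u).
Proof.
move=> c u v; rewrite (@Quotient.pi_add M (in_lspan R) (c *: u) v).
by congr (_ + _); rewrite -[RHS]/(lquot_scale _ _) lquot_scale_pi.
Qed.

(** Universal property of the quotient; [repr u] and u differ by an element of
    the span, on which f vanishes. *)
Lemma lquot_lift (M N : lmodType K) (R : M -> Prop) (f : M -> N) :
  linear f -> (forall u, R u -> f u = 0) ->
  exists2 p : lquot R -> N, linear p & forall u, p (\pi_(lquot R) u) = f u.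
Proof.
move=> lf f0.
have fS u : lspan R u -> f u = 0.
  elim=> [|c x y Rx _ IH]; first exact: linear_zero.
  by rewrite lf f0 // IH scaler0 addr0.
have fpi u : f (repr (\pi_(lquot R) u)) = f u.
  apply/subr0_eq; rewrite -linear_sub //; apply: fS.
  have: repr (\pi_(lquot R) u) - u \in in_lspan R.
    by rewrite Quotient.idealrBE reprK.
  by move/asboolP.
exists (fun x => f (repr x)) => // c x y.
by rewrite -[x]reprK -[y]reprK -lquot_pi_lin !fpi lf.
Qed.

HB.instance Definition _ (T : choiceType) (N : lmodType K) (f : T -> N) :=
  GRing.isZmodMorphism.Build {freeg T / K} N (fglift f) (lift_is_additive f).

Lemma fglift_linear (T : choiceType) (N : lmodType K) (f : T -> N) :
  linear (fglift f : {freeg T / K} -> N).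
Proof.
move=> c u v; rewrite raddfD /=; congr (_ + _).
have -> : c *: u = \sum_(x <- dom u) << c * coeff x u *g x >> by [].
rewrite -[in RHS](freeg_sumE u) !raddf_sum.
by apply: eq_bigr => x _; rewrite /= !liftU scalerA.
Qed.

Lemma freeg_linear_eq (T : choiceType) (N : lmodType K)
    (f g : {freeg T / K} -> N) :
  linear f -> linear g -> (forall x, f << x >> = g << x >>) -> f =1 g.
Proof.
move=> lf lg fg u; rewrite -(freeg_sumE u) !linear_sumE //.
apply: eq_bigr => x _.
have -> : << coeff x u *g x >> = coeff x u *: << x >> :> {freeg T / K}.
  by apply/eqP/freeg_eqP => y; rewrite coeffZ !coeffU mul1r.
by rewrite !linear_scale // fg.
Qed.

Definition word_multilin (E M : lmodType K) (h : seq E -> M) :=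
  forall s t c x y,
    h (s ++ (c *: x + y) :: t) = c *: h (s ++ x :: t) + h (s ++ y :: t).

Lemma word_lift (E M : lmodType K) (h : seq E -> M) :
  word_multilin h -> h [::] = 0 ->
  exists2 p : tpowers E -> M, linear p & forall s, p (word s) = h s.
Proof.
move=> mh h0; have lh := fglift_linear h.
case: (@lquot_lift _ _ (@word_rel K E) _ lh) => [u|p lp pE].
  case=> [|s t c x y]; first by rewrite liftU h0 scaler0.
  by rewrite !linear_sub // linear_scale // !liftU !scale1r mh -addrA -opprD subrr.
by exists p => // s; rewrite pE liftU scale1r.
Qed.

(** The empty word is killed by definition; this lets the sums over subsets below
    include the empty subset. *)
Lemma word_nil (E : lmodType K) : word [::] = 0 :> tpowers E.
Proof.
rewrite /word -(linear_zero (lquot_pi_lin (word_rel (W:=E)))).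
apply: lquot_pi_eq0; rewrite -[_ - _]addr0 -[_ - _]scale1r subr0.
apply: lspanD; [exact: WordNil | exact: lspan0].
Qed.

Lemma word_multilinP (E : lmodType K) : word_multilin (@word K E).
Proof.
move=> s t c x y; rewrite /word -lquot_pi_lin.
apply: lquot_pi_eq0; rewrite opprD addrA -[_ - _]addr0 -[X in X + 0]scale1r.
by apply: lspanD; [exact: WordLin | exact: lspan0].
Qed.

Lemma word_linear_eq (E M : lmodType K) (f g : tpowers E -> M) :
  linear f -> linear g -> (forall s, f (word s) = g (word s)) -> f =1 g.
Proof.
move=> lf lg fg x; rewrite -[x]reprK; move: (repr x).
by apply: freeg_linear_eq => // [c u v|c u v];
   rewrite [in LHS]lquot_pi_lin ?lf ?lg.
Qed.

Lemma tensor_lift (E F M : lmodType K) (h : E -> F -> M) :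
  (forall y, linear (h^~ y)) -> (forall x, linear (h x)) ->
  exists2 p : tensor E F -> M, linear p & forall x y, p (tpair x y) = h x y.
Proof.
move=> hl hr; pose g (u : E * F) := h u.1 u.2.
have lh := fglift_linear g.
case: (@lquot_lift _ _ (@tensor_rel K E F) _ lh) => [u|p lp pE].
  by case=> [c u1 u2 w|c v w1 w2];
     rewrite !linear_sub // linear_scale // !liftU !scale1r /g /= ?hl ?hr -addrA -opprD subrr.
by exists p => // x y; rewrite pE liftU scale1r.
Qed.

Lemma tpair_linl (E F : lmodType K) (y : F) : linear (fun x : E => tpair x y).
Proof.
move=> c u v; rewrite /tpair -lquot_pi_lin.
apply: lquot_pi_eq0; rewrite opprD addrA -[_ - _]addr0 -[X in X + 0]scale1r.
by apply: lspanD; [exact: TensorL | exact: lspan0].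
Qed.

Lemma tpair_linr (E F : lmodType K) (x : E) : linear (fun y : F => tpair x y).
Proof.
move=> c u v; rewrite /tpair -lquot_pi_lin.
apply: lquot_pi_eq0; rewrite opprD addrA -[_ - _]addr0 -[X in X + 0]scale1r.
by apply: lspanD; [exact: TensorR | exact: lspan0].
Qed.

End Lifting.

(** * Homogeneous components *)

Section Components.
Variables (K : fieldType) (n : nat) (W : gradedSpace K n).

Lemma components_ex (x : W) : exists sf : seq (weight n) * (weight n -> W),
  [/\ uniq sf.1, forall d, homog d (sf.2 d), forall d, d \notin sf.1 -> sf.2 d = 0
    & x = \sum_(d <- sf.1) sf.2 d].
Proof.
have [s [f [hf ->]]] := homog_sum x.
exists (undup s, fun d => f d *+ count_mem d s); split=> /= [|d|d|].
- exact: undup_uniq.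
- elim: (count_mem d s) => [|k IH]; first by rewrite mulr0n; apply: homog0.
  by rewrite mulrS -[f d]scale1r; apply: homogP; rewrite ?scale1r.
- by rewrite mem_undup => /count_memPn ->; rewrite mulr0n.
- by rewrite -big_undup_iterop_count.
Qed.

Definition homog_support (x : W) := (projT1 (cid (components_ex x))).1.
Definition component (x : W) := (projT1 (cid (components_ex x))).2.

Lemma componentsP (x : W) :
  [/\ uniq (homog_support x), forall d, homog d (component x d),
      forall d, d \notin homog_support x -> component x d = 0
    & x = \sum_(d <- homog_support x) component x d].
Proof. exact: (projT2 (cid (components_ex x))). Qed.

Lemma component_homog (x : W) d : homog d (component x d).
Proof. by have [] := componentsP x. Qed.

(** Decompositions of several vectors can be compared once their sums run over
    a common set of degrees. *)
Lemma sum_support (M : lmodType K) (x : W) (g : weight n -> W -> M) S :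
  (forall d, g d 0 = 0) -> uniq S -> {subset homog_support x <= S} ->
  \sum_(d <- homog_support x) g d (component x d) = \sum_(d <- S) g d (component x d).
Proof.
move=> g0 uS sub; have [us _ f0 _] := componentsP x.
rewrite [RHS](bigID [in homog_support x]) /= [X in _ + X]big1 ?addr0; last first.
  by move=> d dx; rewrite f0.
rewrite -[RHS]big_filter; apply: perm_big; apply: uniq_perm => //.
  exact: filter_uniq.
by move=> d; rewrite mem_filter; case: (boolP (d \in homog_support x)) => // /sub ->.
Qed.

(** The sum of the homogeneous parts is direct. *)
Lemma component_unique (x : W) S (f : weight n -> W) :
  uniq S -> (forall d, homog d (f d)) -> (forall d, d \notin S -> f d = 0) ->
  x = \sum_(d <- S) f d -> component x =1 f.
Proof.
move=> uS hf f0 xE; have [us hc c0 xE'] := componentsP x.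
pose S' := undup (homog_support x ++ S) => d.
have uS' : uniq S' by apply: undup_uniq.
have subx : {subset homog_support x <= S'}.
  by move=> e ex; rewrite mem_undup mem_cat ex.
have subS : {subset S <= S'} by move=> e ex; rewrite mem_undup mem_cat ex orbT.
case: (boolP (d \in S')) => [dS'|]; last first.
  by rewrite mem_undup mem_cat negb_or => /andP[dx dS]; rewrite c0 // f0.
apply/subr0_eq; apply: (@homog_direct _ _ W S' (fun d => component x d - f d)) => //.
  by move=> e; rewrite addrC -scaleN1r; apply: homogP.
rewrite sumrB -(@sum_support W x (fun d y => y)) // -xE' {1}xE.
rewrite [X in _ - X](bigID [in S]) /= [X in _ - (_ + X)]big1 ?addr0; last first.
  by move=> e eS; rewrite f0.
apply/eqP; rewrite subr_eq0 -[X in _ == X]big_filter; apply/eqP/perm_big.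
apply: uniq_perm => //; first exact: filter_uniq.
by move=> e; rewrite mem_filter; case: (boolP (e \in S)) => // /subS ->.
Qed.

Lemma component_lin c (x y : W) d :
  component (c *: x + y) d = c *: component x d + component y d.
Proof.
pose S := undup (homog_support x ++ homog_support y).
have uS : uniq S by apply: undup_uniq.
have [_ hx x0 xE] := componentsP x; have [_ hy y0 yE] := componentsP y.
move: d; apply: (@component_unique _ S) => //.
- by move=> d; apply: homogP.
- move=> d; rewrite mem_undup mem_cat negb_or => /andP[dx dy].
  by rewrite x0 // y0 // scaler0 addr0.
- rewrite big_split /= -scaler_sumr; congr (_ *: _ + _).
    rewrite {1}xE (@sum_support W x (fun d y => y) S) // => e ex.
    by rewrite mem_undup mem_cat ex.
  rewrite {1}yE (@sum_support W y (fun d y => y) S) // => e ex.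
  by rewrite mem_undup mem_cat ex orbT.
Qed.

(** The linear map that is g d on the vectors of degree d. *)
Definition homog_ext (M : lmodType K) (g : weight n -> W -> M) (x : W) : M :=
  \sum_(d <- homog_support x) g d (component x d).

Lemma homog_ext_linear (M : lmodType K) (g : weight n -> W -> M) :
  (forall d, linear (g d)) -> linear (homog_ext g).
Proof.
move=> lg c x y; pose S := undup (homog_support x ++ homog_support y ++ homog_support (c *: x + y)).
have uS : uniq S by apply: undup_uniq.
have g0 d : g d 0 = 0 by apply: linear_zero.
rewrite /homog_ext !(@sum_support M _ g S) //; first last.
- by move=> d dx; rewrite mem_undup !mem_cat dx !orbT.
- by move=> d dx; rewrite mem_undup !mem_cat dx.
- by move=> d dx; rewrite mem_undup !mem_cat dx !orbT.
rewrite scaler_sumr -big_split; apply: eq_bigr => d _ /=.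
by rewrite component_lin lg.
Qed.

Lemma homog_extE (M : lmodType K) (g : weight n -> W -> M) d x :
  (forall d, linear (g d)) -> homog d x -> homog_ext g x = g d x.
Proof.
move=> lg hx.
have cE : component x =1 (fun e => if e == d then x else 0).
  apply: (@component_unique _ [:: d]) => // [e|e|].
  - by case: eqP => [->|_] //; apply: homog0.
  - by rewrite inE => /negbTE ->.
  - by rewrite big_seq1 eqxx.
pose S := undup (d :: homog_support x).
rewrite /homog_ext (@sum_support M _ g S) //; first last.
- by move=> e ex; rewrite mem_undup in_cons ex orbT.
- exact: undup_uniq.
- by move=> e; apply: linear_zero.
rewrite (bigD1_seq d) /= ?undup_uniq ?mem_undup ?mem_head //.
rewrite cE eqxx big1 ?addr0 // => e ed; rewrite cE (negbTE ed).
exact: linear_zero.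
Qed.

Lemma homog_ext_const (M : lmodType K) (g : W -> M) :
  linear g -> homog_ext (fun=> g) =1 g.
Proof.
move=> lg x; rewrite /homog_ext -(linear_sumE _ _ _ lg).
by congr g; have [_ _ _ <-] := componentsP x.
Qed.

Lemma homog_ext_lin (M : lmodType K) c (g g' : weight n -> W -> M) x :
  homog_ext (fun d y => c *: g d y + g' d y) x = c *: homog_ext g x + homog_ext g' x.
Proof. by rewrite /homog_ext scaler_sumr -big_split. Qed.

Lemma homog_ext_eq (M : lmodType K) (g g' : weight n -> W -> M) x :
  (forall d y, homog d y -> g d y = g' d y) -> homog_ext g x = homog_ext g' x.
Proof.
by move=> gg; rewrite /homog_ext; apply: eq_bigr => d _; apply/gg/component_homog.
Qed.
End Components.

(** * Maps defined on words of homogeneous letters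

    A letter is paired with a degree.  The zero vector is homogeneous of every
    degree, so the degree cannot be read off from the letter. *)

Section DegreeWords.
Variables (K : fieldType) (n : nat).

Definition deg (E : Type) (s : seq (weight n * E)) : weight n := \sum_(l <- s) l.1.

Lemma deg_nil (E : Type) : deg ([::] : seq (weight n * E)) = 0.
Proof. exact: big_nil. Qed.
Lemma deg_cons (E : Type) l (s : seq (weight n * E)) : deg (l :: s) = l.1 + deg s.
Proof. exact: big_cons. Qed.
Lemma deg_cat (E : Type) (s t : seq (weight n * E)) : deg (s ++ t) = deg s + deg t.
Proof. exact: big_cat. Qed.
Lemma deg_rcons (E : Type) (s : seq (weight n * E)) l : deg (rcons s l) = deg s + l.1.
Proof. by rewrite -cats1 deg_cat deg_cons deg_nil addr0. Qed.

Definition multilin (E M : lmodType K) (f : seq (weight n * E) -> M) :=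
  forall s t d c x y,
    f (s ++ (d, c *: x + y) :: t) = c *: f (s ++ (d, x) :: t) + f (s ++ (d, y) :: t).

Lemma multilin_cons (E M : lmodType K) (f : seq (weight n * E) -> M) l :
  multilin f -> multilin (fun s => f (l :: s)).
Proof. by move=> mf s; apply: mf (l :: s). Qed.

Lemma multilin_head (E M : lmodType K) (f : seq (weight n * E) -> M) d s :
  multilin f -> linear (fun x => f ((d, x) :: s)).
Proof. by move=> mf c x y; apply: mf [::] s d c x y. Qed.

Definition letters (E : Type) (s : seq (weight n * E)) := map snd s.

Lemma multilin_letters (E M : lmodType K) (h : seq E -> M) :
  word_multilin h -> multilin (fun s => h (letters s)).
Proof. by move=> mh s t d c x y; rewrite /letters !map_cat mh. Qed.

Definition all_homog (W : gradedSpace K n) (s : seq (weight n * W)) :=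
  forall l, l \in s -> homog l.1 l.2.

Lemma all_homog_cons (W : gradedSpace K n) l (s : seq (weight n * W)) :
  all_homog (l :: s) <-> homog l.1 l.2 /\ all_homog s.
Proof.
split=> [hs|[hl hs] l']; last by rewrite inE => /predU1P[->|/hs].
by split=> [|l' ls]; apply: hs; rewrite inE ?eqxx // ls orbT.
Qed.

Lemma all_homog_cat (W : gradedSpace K n) (s t : seq (weight n * W)) :
  all_homog (s ++ t) <-> all_homog s /\ all_homog t.
Proof.
split=> [h|[hs ht] l]; last by rewrite mem_cat => /orP[/hs|/ht].
by split=> l lst; apply: h; rewrite mem_cat lst ?orbT.
Qed.

Lemma all_homog_rcons (W : gradedSpace K n) (s : seq (weight n * W)) l :
  all_homog (rcons s l) <-> homog l.1 l.2 /\ all_homog s.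
Proof.
rewrite -cats1 all_homog_cat all_homog_cons; split=> [[? []] //|[? ?]].
by do 2!split=> //; move=> ?; rewrite in_nil.
Qed.

(** The letters of the word are split one after the other into homogeneous
    components, and f is summed over the resulting words with degrees. *)
Fixpoint ext_word (W : gradedSpace K n) (M : lmodType K) (s : seq W)
    (f : seq (weight n * W) -> M) : M :=
  if s is x :: s' then homog_ext (fun d y => ext_word s' (fun t => f ((d, y) :: t))) x
  else f [::].

Variables (W : gradedSpace K n) (M : lmodType K).
Implicit Types (f g : seq (weight n * W) -> M) (s t : seq W).

Lemma ext_word_lin s c f g :
  ext_word s (fun u => c *: f u + g u) = c *: ext_word s f + ext_word s g.
Proof.
elim: s f g => //= x s IH f g; rewrite -homog_ext_lin.
by apply: homog_ext_eq => d y _; rewrite IH.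
Qed.

Lemma ext_word_eq s f g :
  (forall u, all_homog u -> size u = size s -> f u = g u) -> ext_word s f = ext_word s g.
Proof.
elim: s f g => [|x s IH] f g fg /=; first by apply: fg => // l; rewrite in_nil.
apply: homog_ext_eq => d y hy; apply: IH => t ht st; apply: fg; last by rewrite /= st.
by apply/all_homog_cons.
Qed.

Lemma ext_word_head_linear s f d :
  multilin f -> linear (fun y => ext_word s (fun u => f ((d, y) :: u))).
Proof.
move=> mf c x y; rewrite -ext_word_lin; apply: ext_word_eq => t _ _.
exact: multilin_head.
Qed.

Lemma ext_word_multilin f : multilin f -> word_multilin (fun s => ext_word s f).
Proof.
move=> mf s t c x y; elim: s f mf => [|z s IH] f mf /=.
  by apply: homog_ext_linear => d; apply: ext_word_head_linear.
rewrite -homog_ext_lin; apply: homog_ext_eq => d u _; rewrite IH //.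
exact: multilin_cons.
Qed.

Lemma ext_wordE f (u : seq (weight n * W)) :
  multilin f -> all_homog u -> ext_word (letters u) f = f u.
Proof.
elim: u f => [|[d x] u IH] f //= mf /all_homog_cons[/= hx hu].
rewrite (@homog_extE _ _ _ _ _ d) //; first by rewrite IH //; apply: multilin_cons.
by move=> e; apply: ext_word_head_linear.
Qed.

(** A function that ignores the degrees is its own extension: this is the source of
    the uniqueness statements [word_eq] and [T_eq]. *)
Lemma ext_word_letters s (h : seq W -> M) :
  word_multilin h -> ext_word s (fun u => h (letters u)) = h s.
Proof.
elim: s h => //= x s IH h mh.
have mh' y : word_multilin (fun t => h (y :: t)) by move=> t; apply: mh (y :: t).
rewrite (_ : homog_ext _ _ = homog_ext (fun _ y => h (y :: s)) x).
  by rewrite homog_ext_const // => c y z; apply: (mh [::]).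
by apply: homog_ext_eq => d y _; apply: (IH (fun t => h (y :: t))).
Qed.

Definition dword (u : seq (weight n * W)) : T W := word (letters u).

(** Formulas that involve the degrees of the letters define linear maps on T(W). *)
Lemma T_lift f : multilin f -> f [::] = 0 ->
  exists2 p : T W -> M, linear p & forall u, all_homog u -> p (dword u) = f u.
Proof.
move=> mf f0.
have [p lp pE] := word_lift (ext_word_multilin mf) f0.
by exists p => // u hu; rewrite pE ext_wordE.
Qed.

(** Restricting to homogeneous words of the same length makes this usable for
    corestrictions, which are specified length by length. *)
Lemma word_eq (F G : T W -> M) s : linear F -> linear G ->
  (forall u, all_homog u -> size u = size s -> F (dword u) = G (dword u)) ->
  F (word s) = G (word s).
Proof.
move=> lF lG FG.
have ml H : linear H -> word_multilin (fun s => H (word s) : M).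
  by move=> lH a b c x y; rewrite word_multilinP lH.
rewrite -[LHS](ext_word_letters s (ml F lF)) -[RHS](ext_word_letters s (ml G lG)).
exact: ext_word_eq.
Qed.

Lemma T_eq (F G : T W -> M) : linear F -> linear G ->
  (forall u, all_homog u -> F (dword u) = G (dword u)) -> F =1 G.
Proof.
move=> lF lG FG; apply: word_linear_eq => // s; apply: word_eq => // u hu _.
exact: FG.
Qed.
End DegreeWords.

(** * The sign bicharacter *)

Section Signs.
Variables (K : fieldType) (n : nat).
Implicit Types a b c : weight n.

Lemma dotC a b : dot a b = dot b a.
Proof. by apply: eq_bigr => i _; rewrite mulrC. Qed.

Lemma dotDl a b c : dot (a + b) c = dot a c + dot b c.
Proof. by rewrite /dot -big_split; apply: eq_bigr => i _; rewrite mxE mulrDl. Qed.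

Lemma sgC a b : sg K a b = sg K b a.
Proof. by rewrite /sg dotC. Qed.

Lemma sgDl a b c : sg K (a + b) c = sg K a c * sg K b c.
Proof. by rewrite /sg dotDl expfzDr // oppr_eq0 oner_eq0. Qed.

Lemma sgDr a b c : sg K a (b + c) = sg K a b * sg K a c.
Proof. by rewrite sgC sgDl !(sgC _ a). Qed.

Lemma sg_sq a b : sg K a b * sg K a b = 1.
Proof. by rewrite -expfzMl mulrNN mulr1 exp1rz. Qed.

Lemma sg0r a : sg K a 0 = 1.
Proof. by rewrite /sg /dot big1 ?expr0z // => i _; rewrite mxE mulr0. Qed.

Lemma sg0l a : sg K 0 a = 1.
Proof. by rewrite sgC sg0r. Qed.

Lemma sgMnl (a b : weight n) k : sg K (a *+ k) b = sg K a b ^+ k.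
Proof. by elim: k => [|k IH]; rewrite ?sg0l // mulrS sgDl IH exprS. Qed.

Lemma sgNr a c : sg K a (- c) = sg K a c.
Proof.
have : sg K a (c - c) = 1 by rewrite subrr sg0r.
rewrite sgDr => e; rewrite -[LHS]mul1r -(sg_sq a c) -mulrA e mulr1.
by [].
Qed.

Lemma sgNl a c : sg K (- a) c = sg K a c.
Proof. by rewrite sgC sgNr sgC. Qed.

Lemma sgMnr a c k : sg K a (c *+ k) = sg K a c ^+ k.
Proof. by rewrite sgC sgMnl sgC. Qed.

Definition sg_odd a c : bool := odd `|dot a c|%N.

(** Signs are compared through the parity of their exponents. *)
Lemma sg_oddE a c : sg K a c = (-1) ^+ sg_odd a c.
Proof.
rewrite /sg /sg_odd signr_odd; case: (dot a c) => k //.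
by rewrite NegzE -exprnN -exprVn invrN1 abszN.
Qed.

End Signs.

(** * Coproduct and coderivations as operators on functions of words *)

Section Unshuffle.
Variables (K : fieldType) (n : nat) (E : lmodType K).
Notation L := (weight n * E)%type.
Implicit Types (s t I J : seq L) (x : L).

(** The sum of F I J over the terms I (x) J of the coproduct of the word s.  The
    first letter goes left, or it goes right and passes all letters of I; the
    last letter is forced to go right. *)
Fixpoint unshuffle (M : lmodType K) (F : seq L -> seq L -> M) s : M :=
  if s is x :: s' then
    if s' is [::] then F [::] [:: x] else
    unshuffle (fun I J => F (x :: I) J) s' +
    unshuffle (fun I J => sg K x.1 (deg I) *: F I (x :: J)) s'
  else 0.

(* the corestriction is split into a scalar k, which carries the sign and the
   restriction on the length, and a vector q *)
Variables (dq : weight n) (k : seq L -> K) (q : seq L -> E).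
Definition insertion J : L := (dq + deg J, q J).

(** The sum of f over the terms of the coderivation with corestriction k q, on the
    word s, where the letters in J have already been chosen as arguments of q.  The
    first letter x of s is either the last argument of q, and the result takes its
    place; or it is left over, and passes q and the letters in J; or it joins J. *)
Fixpoint coextend (M : lmodType K) (f : seq L -> M) J s : M :=
  if s is x :: s' then
    k (rcons J x) *: f (insertion (rcons J x) :: s') +
    sg K (dq + deg J) x.1 *: coextend (fun t => f (x :: t)) J s' +
    coextend f (rcons J x) s'
  else 0.

Section Values.
Variable M : lmodType K.
Implicit Types (f g : seq L -> M) (F G : seq L -> seq L -> M).

Lemma unshuffle_cons F x y s :
  unshuffle F [:: x, y & s] = unshuffle (fun I J => F (x :: I) J) (y :: s) +
    unshuffle (fun I J => sg K x.1 (deg I) *: F I (x :: J)) (y :: s).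
Proof. by []. Qed.

Lemma unshuffle_consE F x s : (0 < size s)%N ->
  unshuffle F (x :: s) = unshuffle (fun I J => F (x :: I) J) s +
    unshuffle (fun I J => sg K x.1 (deg I) *: F I (x :: J)) s.
Proof. by case: s. Qed.

Lemma unshuffle_lin c F G s :
  unshuffle (fun I J => c *: F I J + G I J) s = c *: unshuffle F s + unshuffle G s.
Proof.
elim: s F G => [|x [|y s] IH] F G; rewrite ?scaler0 ?addr0 // !unshuffle_cons IH.
rewrite scalerDr addrACA; congr (_ + _); rewrite -IH; congr unshuffle.
apply/funext => I; apply/funext => J.
by rewrite scalerDr !scalerA mulrC.
Qed.

Lemma unshuffle_add F G s : unshuffle (fun I J => F I J + G I J) s = unshuffle F s + unshuffle G s.
Proof.
rewrite -[unshuffle F s]scale1r -unshuffle_lin; congr unshuffle.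
by apply/funext => I; apply/funext => J; rewrite scale1r.
Qed.

Lemma unshuffle_zero s : unshuffle (fun _ _ => 0 : M) s = 0.
Proof.
have := unshuffle_lin (-1) (fun _ _ => 0) (fun _ _ => 0) s.
by rewrite scaler0 addr0 scaleN1r addNr.
Qed.

Lemma unshuffle_scale c F s : unshuffle (fun I J => c *: F I J) s = c *: unshuffle F s.
Proof.
rewrite -[RHS]addr0 -(unshuffle_zero s) -unshuffle_lin; congr unshuffle.
by apply/funext => I; apply/funext => J; rewrite addr0.
Qed.

Lemma coextend_lin c f g J s :
  coextend (fun t => c *: f t + g t) J s = c *: coextend f J s + coextend g J s.
Proof.
elim: s f g J => [|x s IH] f g J /=; first by rewrite scaler0 addr0.
rewrite !IH !scalerDr [X in X + _]addrACA [LHS]addrACA.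
by rewrite !scalerA ![c * _]mulrC.
Qed.

Lemma coextend_eq_cons f g J s :
  (forall x t, f (x :: t) = g (x :: t)) -> coextend f J s = coextend g J s.
Proof.
by elim: s f g J => [|x s IH] f g J fg //=; rewrite fg (IH _ _ _ fg)
  (IH (fun t => f (x :: t)) (fun t => g (x :: t))).
Qed.

Lemma coextend_add f g J s : coextend (fun t => f t + g t) J s = coextend f J s + coextend g J s.
Proof.
rewrite -[coextend f J s]scale1r -coextend_lin; apply: coextend_eq_cons => x t.
by rewrite scale1r.
Qed.

Lemma coextend_zero J s : coextend (fun=> 0 : M) J s = 0.
Proof.
by elim: s J => //= x s IH J; rewrite !IH !scaler0 !addr0.
Qed.

Lemma coextend_scale c f J s : coextend (fun t => c *: f t) J s = c *: coextend f J s.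
Proof.
rewrite -[RHS]addr0 -(coextend_zero J s) -coextend_lin.
by apply: coextend_eq_cons => x t; rewrite addr0.
Qed.

(** All terms have the same degree. *)
Lemma coextend_sg d f J s :
  coextend (fun t => sg K d (deg t) *: f t) J s =
    sg K d (dq + deg J + deg s) *: coextend f J s.
Proof.
elim: s f J => [|x s IH] f J /=; first by rewrite scaler0.
rewrite IH !deg_cons deg_rcons /=.
rewrite (_ : coextend (fun t => sg K d (deg (x :: t)) *: f (x :: t)) J s
   = sg K d x.1 *: coextend (fun t => sg K d (deg t) *: f (x :: t)) J s); last first.
  rewrite -coextend_scale; congr coextend; apply/funext => t.
  by rewrite deg_cons sgDr scalerA.
rewrite IH !scalerDr !scalerA !addrA; congr (_ + _ + _).
- by rewrite deg_rcons addrA mulrC.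
- by rewrite !sgDr; congr (_ *: _); ring.
Qed.

(** The co-Leibniz rule.  A term on the left inserts q(J) and then splits the word;
    a term on the right splits the word and then inserts q(J) in one of the two
    factors.  The letter q(J) is a block of degree dq + deg J for the first, and
    the sign of the second arises when the block passes the letters of I.  Sorting
    the terms by the role of the first letter yields the same eight sums on both
    sides. *)
Lemma coextend_unshuffle F J s :
  coextend (unshuffle F) J s =
  unshuffle (fun I I' => coextend (F^~ I') J I +
                    sg K (dq + deg J) (deg I) *: coextend (F I) J I') s.
Proof.
elim: s F J => // x [|y s] IH F J.
  by rewrite /= deg_nil sg0r !scale1r !scaler0 !addr0 add0r.
have stepE f : coextend f J [:: x, y & s] =
  k (rcons J x) *: f (insertion (rcons J x) :: y :: s) +
  sg K (dq + deg J) x.1 *: coextend (fun t => f (x :: t)) J (y :: s) +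
  coextend f (rcons J x) (y :: s) by [].
rewrite stepE (IH F (rcons J x)) !unshuffle_cons.
have -> : coextend (fun t => unshuffle F (x :: t)) J (y :: s) =
  coextend (unshuffle (fun I I' => F (x :: I) I')) J (y :: s) +
  coextend (unshuffle (fun I I' => sg K x.1 (deg I) *: F I (x :: I'))) J (y :: s).
  by rewrite -coextend_add; apply: coextend_eq_cons.
rewrite !IH -!unshuffle_add -!unshuffle_scale -!unshuffle_add; congr unshuffle.
apply/funext => I; apply/funext => I' /=.
rewrite coextend_scale coextend_sg !deg_cons deg_rcons.
rewrite !scalerDr !scalerA !sgDl !sgDr.
rewrite [LHS](AC ((2*(2*2))*2) ((1*3*7*4)*(5*((2*6)*8)))).
have sq := sg_sq K (dq + deg J) x.1; rewrite sgDl in sq.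
congr (_ + _ + _ + _ *: _ + (_ *: _ + (_ *: _ + _ *: _ + _ *: _))).
- by ring.
- by rewrite !(sgC K x.1) -[RHS]mul1r -sq; ring.
- by ring.
- by ring.
- by ring.
Qed.
End Values.
End Unshuffle.

(** * Unshuffles as sums over subsets *)

Section Subsets.
Variables (K : fieldType) (n : nat).

(** The subsets of {0, ..., p} in terms of those of {0, ..., p-1}: b tells whether
    0 belongs to the set, and I is shifted by one. *)
Definition cons_set p (b : bool) (I : {set 'I_p}) : {set 'I_p.+1} :=
  [set i : 'I_p.+1 | oapp (fun j => j \in I) b (unlift ord0 i)].

Lemma cons_set0 p b (I : {set 'I_p}) : (ord0 \in cons_set b I) = b.
Proof. by rewrite inE unlift_none. Qed.

Lemma cons_setS p b (I : {set 'I_p}) j : (lift ord0 j \in cons_set b I) = (j \in I).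
Proof. by rewrite inE liftK. Qed.

Lemma cons_setC p b (I : {set 'I_p}) : ~: cons_set b I = cons_set (~~ b) (~: I).
Proof.
by apply/setP => i; rewrite !inE; case: unliftP => [j _|_] /=; rewrite ?inE.
Qed.

Lemma cons_set_bij p :
  bijective (fun bI : bool * {set 'I_p} => cons_set bI.1 bI.2).
Proof.
exists (fun A : {set 'I_p.+1} => (ord0 \in A, [set j | lift ord0 j \in A])).
  move=> [b I] /=; rewrite cons_set0; congr (_, _).
  by apply/setP => j; rewrite !inE liftK.
by move=> A /=; apply/setP => i; rewrite inE; case: unliftP => [j|] -> /=; rewrite ?inE.
Qed.

Lemma enum_cons_set p b (I : {set 'I_p}) :
  enum (cons_set b I) = nseq b ord0 ++ map (lift ord0) (enum I).
Proof.
have enumF q (A : {set 'I_q}) : enum A = [seq i <- enum 'I_q | i \in A].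
  by rewrite enumT.
rewrite !enumF enum_ordSl /= cons_set0 filter_map.
rewrite (eq_filter (a2 := [in I])); last by move=> j /=; rewrite cons_setS.
by case: b.
Qed.

(** The sign [koszul] of the rearrangement of A and its complement, with the
    complement in place of an arbitrary second set. *)
Definition shuffle_sign p (d : 'I_p -> weight n) (A : {set 'I_p}) : K :=
  \prod_(i in A) \prod_(j in ~: A | (j < i)%N) sg K (d i) (d j).

Lemma shuffle_sign_cons p (d : 'I_p.+1 -> weight n) b (I : {set 'I_p}) :
  shuffle_sign d (cons_set b I) =
  (if b then 1 else \prod_(i in I) sg K (d ord0) (d (lift ord0 i))) *
  shuffle_sign (fun i => d (lift ord0 i)) I.
Proof.
rewrite /shuffle_sign cons_setC big_mkcond big_ord_recl /=.
rewrite [X in X * _](_ : _ = 1) ?mul1r; last first.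
  by case: ifP => // _; rewrite big_pred0 // => j; rewrite andbF.
rewrite (eq_bigr (fun i : 'I_p => if i \in I then
   (if b then 1 else sg K (d ord0) (d (lift ord0 i))) *
   \prod_(j in ~: I | (j < i)%N) sg K (d (lift ord0 i)) (d (lift ord0 j))
   else 1)); last first.
  move=> i _; rewrite cons_setS; case: ifP => // _.
  rewrite big_mkcond big_ord_recl cons_set0 andbT; congr (_ * _).
    by case: b; rewrite //= sgC.
  rewrite [RHS]big_mkcond; apply: eq_bigr => j _.
  by rewrite cons_setS.
rewrite -big_mkcond big_split /=; congr (_ * _).
by case: b => //; rewrite big1.
Qed.

Lemma sg_deg (E : Type) a p (w : 'I_p -> weight n * E) (I : {set 'I_p}) :
  sg K a (deg [seq w i | i in I]) = \prod_(i in I) sg K a (w i).1.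
Proof.
rewrite /deg big_map big_enum /=.
elim/big_rec2: _ => [|i x y _ <-]; [exact: sg0r | exact: sgDr].
Qed.

(** Sorting the subsets by whether they contain 0 reproduces the recursion on the
    first letter. *)
Lemma unshuffle_subsets (E M : lmodType K) p (w : 'I_p.+1 -> weight n * E)
    (F : seq (weight n * E) -> seq (weight n * E) -> M) :
  \sum_(I : {set 'I_p.+1} | ord_max \notin I)
    shuffle_sign (fun i => (w i).1) I *:
      F [seq w i | i in I] [seq w i | i in ~: I] = unshuffle F (map w (enum 'I_p.+1)).
Proof.
elim: p w F => [|p IH] w F.
  rewrite (big_pred1 set0); last first.
    move=> I; rewrite [RHS]eqEsubset sub0set andbT; apply/idP/idP => [I0|/subsetP I0].
      apply/subsetP => i; rewrite (_ : i = ord_max) ?(negbTE I0) //.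
      by rewrite [i]ord1 [RHS]ord1.
    by apply/negP => /I0; rewrite inE.
  rewrite /shuffle_sign big_set0 scale1r /image_mem enum_set0 setC0 enum_ordSl.
  have -> : enum [set: 'I_1] = enum 'I_1 by apply: eq_enum => i; rewrite inE.
  by rewrite enum_ordSl /= (size0nil (s := enum 'I_0)) // size_enum_ord.
rewrite (reindex (fun bI : bool * {set 'I_p.+1} => cons_set bI.1 bI.2)); last first.
  exact: (onW_bij _ (cons_set_bij p.+1)).
rewrite (eq_bigl (fun bI : bool * {set 'I_p.+1} => predT bI.1 && (ord_max \notin bI.2)));
  last first.
  move=> [b I] /=; congr (~~ _).
  rewrite (_ : ord_max = lift ord0 ord_max) ?cons_setS //; exact: val_inj.
rewrite -(pair_big predT (fun I : {set 'I_p.+1} => ord_max \notin I)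
   (fun b I => shuffle_sign (fun i => (w i).1) (cons_set b I) *:
      F [seq w i | i in cons_set b I] [seq w i | i in ~: cons_set b I])) big_bool.
rewrite enum_ordSl map_cons -map_comp unshuffle_consE; last first.
  by rewrite size_map -cardE card_ord.
rewrite -!(IH (w \o lift ord0)).
congr (_ + _); apply: eq_bigr => I _; rewrite shuffle_sign_cons cons_setC.
  by rewrite mul1r /image_mem !enum_cons_set /= -!map_comp.
rewrite /image_mem !enum_cons_set /= -!map_comp scalerA mulrC.
by rewrite -(sg_deg _ (fun i => w (lift ord0 i))).
Qed.
End Subsets.

(** * The tensor coalgebra *)

Section TensorCoalgebra.
Variables (K : fieldType) (n : nat) (W : gradedSpace K n).
Notation L := (weight n * W)%type.
Notation xgetPex := classical_sets.xgetPex.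

Lemma dword_multilin : multilin (@dword K n W).
Proof. exact: multilin_letters (@word_multilinP K W). Qed.

Lemma unshuffle_multilin (M : lmodType K) (F : seq L -> seq L -> M) :
  (forall J, multilin (F^~ J)) -> (forall I, multilin (F I)) ->
  multilin (unshuffle F).
Proof.
move=> Fl Fr s t d c x y; elim: s F Fl Fr => [|z s IH] F Fl Fr; rewrite ?cat0s ?cat_cons.
  case: t => [|z t]; first exact: (Fr [::] [::] [::]).
  rewrite !unshuffle_cons scalerDr addrACA -!unshuffle_lin; congr (_ + _); congr unshuffle;
    apply/funext => I; apply/funext => J.
    exact: (multilin_head d I (Fl J)).
  by rewrite (multilin_head d J (Fr I)) scalerDr !scalerA mulrC.
have step u : unshuffle F (z :: s ++ (d, u) :: t) =
    unshuffle (fun I J => F (z :: I) J) (s ++ (d, u) :: t) +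
    unshuffle (fun I J => sg K z.1 (deg I) *: F I (z :: J)) (s ++ (d, u) :: t).
  by rewrite unshuffle_consE // size_cat addnS.
rewrite step (IH (fun I J => F (z :: I) J)); first last.
- by move=> I; apply: Fr.
- by move=> J; apply: (multilin_cons z (Fl J)).
rewrite (IH (fun I J => sg K z.1 (deg I) *: F I (z :: J))); first last.
- by move=> I a b e c' x' y'; rewrite -!cat_cons Fr scalerDr !scalerA mulrC.
- move=> J a b e c' x' y'; rewrite Fl scalerDr !scalerA mulrC.
  by rewrite !deg_cat !deg_cons.
by rewrite !step scalerDr addrACA.
Qed.

(** The first factor of a term of the coproduct is shorter than the word, as the
    last letter goes right; inductions on the length rest on this. *)
Lemma unshuffle_eq (M : lmodType K) (F G : seq L -> seq L -> M) s :
  all_homog s ->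
  (forall I J, all_homog I -> all_homog J -> (size I < size s)%N ->
     (size I + size J = size s)%N -> F I J = G I J) ->
  unshuffle F s = unshuffle G s.
Proof.
elim: s F G => // x [|y s] IH F G /all_homog_cons[hx hs] FG.
  by apply: FG => //; apply/all_homog_cons.
rewrite !unshuffle_cons; congr (_ + _); apply: IH => // I J hI hJ sI sIJ.
  apply: FG => //; first exact/all_homog_cons.
  by rewrite /= addSn sIJ.
rewrite FG //; first exact/all_homog_cons; first exact: leqW.
by rewrite /= addnS sIJ.
Qed.

Lemma linear_unshuffle (M N : lmodType K) (H : M -> N) (F : seq L -> seq L -> M) s :
  linear H -> H (unshuffle F s) = unshuffle (fun I J => H (F I J)) s.
Proof.
move=> lH; elim: s F => [|x [|y s] IH] F //; first exact: linear_zero.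
rewrite !unshuffle_cons linear_add // !IH; congr (_ + unshuffle _ _).
by apply/funext => I; apply/funext => J; rewrite linear_scale.
Qed.

Definition dletters p (d : p.-tuple (weight n)) (w : p.-tuple W) : seq L :=
  [seq (tnth d i, tnth w i) | i <- enum 'I_p].

Lemma letters_dletters p (d : p.-tuple (weight n)) (w : p.-tuple W) :
  letters (dletters d w) = w.
Proof. by rewrite /letters -map_comp map_tnth_enum. Qed.

Lemma degrees_dletters p (d : p.-tuple (weight n)) (w : p.-tuple W) :
  map fst (dletters d w) = d.
Proof. by rewrite -map_comp map_tnth_enum. Qed.

Lemma size_dletters p (d : p.-tuple (weight n)) (w : p.-tuple W) :
  size (dletters d w) = p.
Proof. by rewrite size_map size_enum_ord. Qed.

Lemma deg_dletters p (d : p.-tuple (weight n)) (w : p.-tuple W) :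
  deg (dletters d w) = \sum_(i < p) tnth d i.
Proof. by rewrite /deg big_map big_enum. Qed.

Lemma all_homog_dletters p (d : p.-tuple (weight n)) (w : p.-tuple W) :
  homogs d w -> all_homog (dletters d w).
Proof. by move=> h l /mapP[i _ ->]; apply: h. Qed.

Lemma dlettersP (u : seq L) p : all_homog u -> size u = p ->
  exists (d : p.-tuple (weight n)) (w : p.-tuple W),
    homogs d w /\ dletters d w = u.
Proof.
move=> hu <-; exists (map_tuple fst (in_tuple u)), (map_tuple snd (in_tuple u)).
split=> [i|]; first by rewrite !tnth_map; apply/hu/mem_tnth.
rewrite /dletters -[RHS](map_tnth_enum (in_tuple u)); apply: eq_map => i.
by rewrite !tnth_map -surjective_pairing.
Qed.

Lemma dword_dletters p (d : p.-tuple (weight n)) (w : p.-tuple W) :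
  dword (dletters d w) = word w.
Proof. by rewrite /dword letters_dletters. Qed.

Lemma homogT_dword (u : seq L) : all_homog u -> homogT (deg u) (dword u).
Proof.
case: u => [|l u] hu; first by rewrite /dword word_nil; apply: lspan0.
have [d [w [hw uE]]] := dlettersP hu erefl.
rewrite -[dword _]addr0 -[dword _]scale1r; apply: lspanD; last exact: lspan0.
by exists (size u), w, d; split; rewrite // -uE ?deg_dletters // dword_dletters.
Qed.

Lemma homogT_lin d c (x y : T W) :
  homogT d x -> homogT d y -> homogT d (c *: x + y).
Proof. exact: lspan_lin. Qed.

Lemma homogT_ind d (P : T W -> Prop) :
  P 0 -> (forall c x y, P x -> P y -> P (c *: x + y)) ->
  (forall u, all_homog u -> deg u = d -> P (dword u)) ->
  forall x, homogT d x -> P x.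
Proof.
move=> P0 Plin Pw x; elim=> // c {}x y [p [w [dw [hw dE ->]]]] _ IH.
apply: Plin => //; rewrite -(dword_dletters dw); apply: Pw.
  exact: all_homog_dletters.
by rewrite deg_dletters.
Qed.

Lemma proj1TP : [/\ linear (@proj1T K W), forall w : W, proj1T (word [:: w]) = w
  & forall s : seq W, size s != 1%N -> proj1T (word s) = 0].
Proof.
apply: (@xgetPex (T W -> W) (fun=> 0) (fun p => [/\ linear p, forall w, p (word [:: w]) = w
  & forall s, size s != 1%N -> p (word s) = 0])).
case: (@word_lift K W W (fun s => if s is [:: x] then x else 0)) => //.
  by move=> [|z s] [|u t] c x y //=; rewrite ?scaler0 ?addr0 //;
     case: s => [|? ?] /=; rewrite scaler0 addr0.
move=> p lp pE; exists p; split=> // [w|s s1]; rewrite pE //.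
by case: s s1 => [|? [|? ?]].
Qed.

Definition dpair (I J : seq L) : tensor (T W) (T W) := tpair (dword I) (dword J).

Lemma dpair_multilin :
  (forall J, multilin (dpair^~ J)) /\ (forall I, multilin (dpair I)).
Proof.
split=> I s t d c x y; rewrite /dpair dword_multilin.
  exact: tpair_linl.
exact: tpair_linr.
Qed.

Lemma enum_setC_max p (I : {set 'I_p.+1}) : ord_max \notin I ->
  enum (~: I) = rcons (enum ([set~ ord_max] :\: I)) ord_max.
Proof.
move=> mI.
have enumF (A : {set 'I_p.+1}) : enum A = [seq i <- enum 'I_p.+1 | i \in A].
  by rewrite enumT.
rewrite !enumF enum_ordSr !filter_rcons !inE mI eqxx /=.
congr rcons; apply: eq_in_filter => i /mapP[j _ ->].
by rewrite !inE -val_eqE /= neq_ltn ltn_ord /= andbT.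
Qed.

Lemma unshuffle_coproduct p (w : p.+1.-tuple W) (d : p.+1.-tuple (weight n)) :
  unshuffle dpair (dletters d w) =
  \sum_(I : {set 'I_p.+1} | (I != set0) && (I \subset [set~ ord_max]))
        koszul K d I ([set~ ord_max] :\: I) *:
          tpair (word (subword w I))
                (word (rcons (subword w ([set~ ord_max] :\: I))
                             (tnth w ord_max))).
Proof.
rewrite -(unshuffle_subsets (fun i => (tnth d i, tnth w i)) dpair).
rewrite [RHS]big_mkcondl; apply: eq_big => I.
  by rewrite subsetC sub1set inE.
move=> mI; have [->|I0] := eqVneq I set0.
  rewrite /dpair {1}/dword /image_mem enum_set0 word_nil.
  by rewrite (linear_zero (tpair_linl _)) scaler0.
congr (_ *: tpair (word _) (word _)).
- apply: eq_bigr => i iI; apply: eq_bigl => j; rewrite !inE.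
  case: (ltnP j i) => ji; rewrite ?andbF // !andbT.
  by rewrite -val_eqE /= neq_ltn (leq_trans ji) ?andbT // -ltnS ltn_ord.
- by rewrite /letters /image_mem -map_comp.
- by rewrite /letters /image_mem enum_setC_max // -map_comp map_rcons.
Qed.

(** The recursive sum is linear in each letter, so it defines a linear map, which
    meets the specification of the coproduct by [unshuffle_coproduct]. *)
Lemma coproductP : linear (@coproduct K n W) /\
  forall u : seq L, all_homog u -> coproduct (dword u) = unshuffle dpair u.
Proof.
have [dl dr] := dpair_multilin.
pose P (D : T W -> tensor (T W) (T W)) := linear D /\
  forall p (w : p.+1.-tuple W) (d : p.+1.-tuple (weight n)), homogs d w ->
      D (word w) =
      \sum_(I : {set 'I_p.+1} | (I != set0) && (I \subset [set~ ord_max]))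
        koszul K d I ([set~ ord_max] :\: I) *:
          tpair (word (subword w I))
                (word (rcons (subword w ([set~ ord_max] :\: I))
                             (tnth w ord_max))).
have [lD DE] : P (@coproduct K n W).
  apply: xgetPex; have [D lD DE] := T_lift (unshuffle_multilin dl dr) erefl.
  exists D; split=> // p w d hw.
  by rewrite -(dword_dletters d) DE ?unshuffle_coproduct //; apply: all_homog_dletters.
split=> // -[|l u] hu; first by rewrite /dword word_nil linear_zero.
have [d [w [hw uE]]] := dlettersP hu erefl.
by rewrite -uE dword_dletters (DE _ _ d) // unshuffle_coproduct.
Qed.

(** Multiplication by (-1)^<a, v> is linear in v.  It absorbs the sign in the tensor
    product of two maps, which becomes a plain bilinear expression. *)
Lemma twist_ex a : exists2 S : T W -> T W, linear S &
  forall d x, homogT d x -> S x = sg K a d *: x.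
Proof.
have m : multilin (fun u : seq L => sg K a (deg u) *: dword u).
  move=> s t d c x y; rewrite dword_multilin scalerDr !scalerA mulrC.
  by rewrite !deg_cat !deg_cons.
have [|S lS SE] := T_lift m; first by rewrite /dword word_nil scaler0.
exists S => // d; apply: homogT_ind => [|c x y xE yE|u hu <-].
- by rewrite linear_zero // scaler0.
- by rewrite lS xE yE scalerDr !scalerA mulrC.
- exact: SE.
Qed.

Lemma tensor_mapP (f g : T W -> T W) a : linear f -> linear g ->
  linear (tensor_map f a g) /\ forall d x y, homogT d x ->
      tensor_map f a g (tpair x y) = sg K a d *: tpair (f x) (g y).
Proof.
move=> lf lg; have [S lS SE] := twist_ex a.
apply: (@xgetPex (tensor (T W) (T W) -> tensor (T W) (T W)) (fun=> 0) (fun F => linear F /\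
    forall d x y, homogT d x ->
      F (tpair x y) = sg K a d *: tpair (f x) (g y))).
case: (@tensor_lift K (T W) (T W) _ (fun x y => tpair (f (S x)) (g y)))
  => [y c x x'|x c y y'|F lF FE].
- by rewrite lS lf tpair_linl.
- by rewrite lg tpair_linr.
exists F; split=> // d x y hx.
by rewrite FE (SE _ _ hx) linear_scale // (linear_scale _ _ (tpair_linl _)).
Qed.

Lemma id_linear (M : lmodType K) : linear (@id M). Proof. by []. Qed.

Definition leibniz q (Q : T W -> T W) z :=
  tensor_map Q 0 id z + tensor_map id q Q z.

Lemma leibnizE q (Q : T W -> T W) d x y : linear Q -> homogT d x ->
  leibniz q Q (tpair x y) = tpair (Q x) y + sg K q d *: tpair x (Q y).
Proof.
move=> lQ hx; rewrite /leibniz.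
have [_ l1] := tensor_mapP 0 lQ (@id_linear (T W)).
have [_ l2] := tensor_mapP q (@id_linear (T W)) lQ.
by rewrite (l1 _ _ _ hx) (l2 _ _ _ hx) sg0l scale1r.
Qed.

Lemma leibniz_linear q (Q : T W -> T W) : linear Q -> linear (leibniz q Q).
Proof.
move=> lQ c x y; rewrite /leibniz.
have [-> _] := tensor_mapP 0 lQ (@id_linear _).
have [-> _] := tensor_mapP q (@id_linear _) lQ.
by rewrite scalerDr addrACA.
Qed.

Lemma leibniz_unshuffle q (Q : T W -> T W) u : linear Q -> all_homog u ->
  leibniz q Q (coproduct (dword u)) =
  unshuffle (fun I J => tpair (Q (dword I)) (dword J) +
                   sg K q (deg I) *: tpair (dword I) (Q (dword J))) u.
Proof.
move=> lQ hu; have [_ ->] // := coproductP.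
rewrite linear_unshuffle; last exact: leibniz_linear.
by apply: unshuffle_eq => // I J hI hJ _ _; rewrite (leibnizE _ _ lQ (homogT_dword hI)).
Qed.

(** Exactly one term has a single letter on the right; it carries no sign. *)
Lemma unshuffle_last (M : lmodType K) (f : seq L -> M) u : all_homog u -> u != [::] ->
  unshuffle (fun I J => if J is [:: l] then f (rcons I l) else 0) u = f u.
Proof.
elim: u f => // x [|y u] IH f /all_homog_cons[_ hu] _ //.
rewrite unshuffle_cons (IH (fun v => f (x :: v))) // -[RHS]addr0; congr (_ + _).
transitivity (unshuffle (fun _ _ => 0 : M) (y :: u)); last exact: unshuffle_zero.
apply: unshuffle_eq => // I [|j J] _ _ sI sIJ.
  by rewrite -sIJ addn0 ltnn in sI.
by rewrite scaler0.
Qed.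

(** A is the projection of the second factor to W followed by concatenation.  It
    restores every word of length at least two from its coproduct, by
    [unshuffle_last], and it kills the coproduct of a single letter, whose first
    factor is the empty word. *)
Lemma append_ex : exists2 A : tensor (T W) (T W) -> T W, linear A &
  forall x, A (coproduct x) + word [:: (proj1T x : W)] = x.
Proof.
have [lp p1 p0] := proj1TP.
have word0 : word [:: 0 : W] = 0 by apply: (linear_zero (word_multilinP [::] [::])).
have app y : exists2 a : T W -> T W, linear a &
    forall s, s != [::] -> a (word s) = word (rcons s y).
  case: (@word_lift K W (T W) (fun s => if s is [::] then 0 else word (rcons s y))) => //.
    move=> [|z s] t c x x' /=; first exact: (word_multilinP [::]).
    by rewrite !rcons_cat; apply: (word_multilinP (z :: s) (rcons t y)).
  by move=> a la aE; exists a => // -[|z s] //= _; rewrite aE.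
pose a y := projT1 (cid2 (app y)).
have la y : linear (a y) by rewrite /a; case: cid2.
have aE y s : s != [::] -> a y (word s) = word (rcons s y).
  by rewrite /a; case: cid2 => /= f _; apply.
have la' x : linear (fun y => a y x).
  move=> c y y'; have lcomb : linear (fun x => c *: a y x + a y' x).
    by move=> e v v'; rewrite !la !scalerDr !scalerA mulrC addrACA.
  apply: (word_linear_eq (la _) lcomb) => -[|z s].
    by rewrite word_nil !(linear_zero (la _)) scaler0 addr0.
  by rewrite !aE // -!cats1 word_multilinP.
case: (@tensor_lift K (T W) (T W) (T W) (fun x y => a (proj1T y) x)).
- by move=> y; apply: la.
- by move=> x c y y'; rewrite lp la'.
move=> A lA AE; exists A => //; have [lD DE] := coproductP.
apply: T_eq => [c x y|//|u hu].
  rewrite lD lA lp scalerDr addrACA; congr (_ + _).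
  exact: (word_multilinP [::] [::]).
rewrite DE // linear_unshuffle // /dpair.
have [->|u0] := eqVneq u [::].
  by rewrite /= /dword word_nil add0r (linear_zero lp) word0.
have [u1|u1] := eqVneq (size u) 1%N.
  case: u u1 {hu u0} => [|l [|? ?]] //= _.
  by rewrite AE /dword word_nil (linear_zero (la _)) add0r p1.
rewrite [proj1T _]p0 ?size_map // word0 addr0.
rewrite -[RHS](unshuffle_last (@dword K n W)) //.
apply: unshuffle_eq => // I J _ _ sI sIJ; rewrite AE.
have [I0|I0] := eqVneq I [::].
  rewrite I0 [X in a _ X]word_nil (linear_zero (la _)).
  by move: sIJ u1; rewrite I0 => <-; case: J => [|j [|j' J]].
case: J {sI sIJ} => [|j [|j' J]].
- by rewrite [X in proj1T X]word_nil linear_zero // (linear_zero (la' _)).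
- rewrite [proj1T _]p1 aE /dword /letters ?map_rcons //.
  by case: (I) I0.
- by rewrite [proj1T _]p0 // (linear_zero (la' _)).
Qed.
End TensorCoalgebra.

(** * Uniqueness of coderivations, and their commutators *)

Section Coderivations.
Variables (K : fieldType) (n : nat) (W : gradedSpace K n).
Notation L := (weight n * W)%type.

(** By [append_ex] it is enough to compare the coproducts of Q(u) and Q'(u).  These
    involve Q and Q' only on words shorter than u, except in the term whose first
    factor is empty, hence zero. *)
Lemma coderivation_unique q (Q Q' : T W -> T W) :
  coderivation q Q -> coderivation q Q' ->
  (forall u, all_homog u -> proj1T (Q (dword u)) = proj1T (Q' (dword u))) ->
  Q =1 Q'.
Proof.
move=> [lQ _ cQ] [lQ' _ cQ'] QQ'; apply: T_eq => // u.
have [A _ AE] := append_ex W.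
have [m] := ubnP (size u); elim: m u => // m IH u um hu.
rewrite -[LHS]AE -[RHS]AE QQ' //; congr (A _ + _).
rewrite cQ cQ' -!/(leibniz _ _ _) !leibniz_unshuffle //.
apply: unshuffle_eq => // I J hI hJ sI sIJ.
rewrite (IH I) //; last exact: leq_trans sI _.
have [->|I0] := eqVneq I [::].
  by rewrite [dword [::]]word_nil !(linear_zero (tpair_linl _)).
rewrite (IH J) //; rewrite -ltnS; apply: leq_ltn_trans um.
by rewrite -sIJ; case: (I) I0 => //= i I' _; rewrite addSn ltnS leq_addl.
Qed.

Lemma commutator_linear q q' (Q Q' : T W -> T W) :
  linear Q -> linear Q' -> linear (commutator q Q q' Q').
Proof.
move=> lQ lQ' c x y; rewrite /commutator !lQ' !lQ !lQ' !scalerDr opprD addrACA.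
by rewrite scalerN !scalerA mulrC.
Qed.

(** The mixed terms, in which Q and Q' act on different factors, cancel. *)
Lemma commutator_coderivation q q' (Q Q' : T W -> T W) :
  coderivation q Q -> coderivation q' Q' ->
  coderivation (q + q') (commutator q Q q' Q').
Proof.
move=> [lQ hQ cQ] [lQ' hQ' cQ'].
have lc := commutator_linear q q' lQ lQ'.
split=> // [d x hx|].
  rewrite /commutator [_ - _]addrC -scaleNr; apply: homogT_lin.
    by rewrite addrA; apply/hQ'/hQ.
  by rewrite [q + q']addrC addrA; apply/hQ/hQ'.
have [lD _] := coproductP W.
have lL := @leibniz_linear _ _ W.
apply: T_eq => [c x y|c x y|u hu].
- by rewrite lc lD.
- by rewrite lD [LHS](lL _ _ lc).
have cQu P p P' p' : linear P -> linear P' ->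
    (forall x, coproduct (P x) = leibniz p P (coproduct x)) ->
    (forall x, coproduct (P' x) = leibniz p' P' (coproduct x)) ->
    coproduct (P (P' (dword u))) = unshuffle (fun I J => leibniz p P
      (tpair (P' (dword I)) (dword J) +
       sg K p' (deg I) *: tpair (dword I) (P' (dword J)))) u.
  move=> lP lP' cP cP'; rewrite cP cP' leibniz_unshuffle //.
  by rewrite (linear_unshuffle _ _ (lL _ _ lP)).
rewrite -/(leibniz _ _ _) leibniz_unshuffle // {1}/commutator.
rewrite (linear_sub lD) (linear_scale _ _ lD) (cQu Q q Q' q') // (cQu Q' q' Q q) //.
rewrite -scaleN1r -!unshuffle_scale -unshuffle_add; apply: unshuffle_eq => // I J hI hJ _ _.
have hT := homogT_dword hI.
rewrite !(linear_add _ _ (lL _ _ _)) // !(linear_scale _ _ (lL _ _ _)) //.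
rewrite !(leibnizE _ _ _ hT) // !(leibnizE _ _ _ (hQ _ _ hT)) //.
rewrite !(leibnizE _ _ _ (hQ' _ _ hT)) // /commutator.
rewrite (linear_sub (tpair_linl _)) (linear_scale _ _ (tpair_linl _)).
rewrite (linear_sub (tpair_linr _)) (linear_scale _ _ (tpair_linr _)).
rewrite !scalerDr !scalerA !mulN1r !scaleNr.
rewrite [LHS](AC ((2*2)*(2*2)) (((1*5)*(4*8))*((2*7)*(3*6)))).
rewrite /= -!scalerDl !sgDr !sgDl (sgC K q q') !mulNr.
have := sg_sq K q' q.
move: (sg K q' q) (sg K q (deg I)) (sg K q' (deg I)) => a b c a2.
rewrite (_ : b * a - a * b = 0); last by ring.
rewrite (_ : c - a * (c * a) = 0); last first.
  have -> : c - a * (c * a) = c * (1 - a * a) by ring.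
  by rewrite a2 subrr mulr0.
rewrite !scale0r !addr0 scalerN scalerA scaleNr; 
  congr (_ + (_ *: _ - _ *: _)); ring.
Qed.
End Coderivations.

(** * Existence of coderivations with a given corestriction

    The corestriction k q is supported on words of length p0, and k only depends on
    the degrees of the letters. *)

Section Extension.
Variables (K : fieldType) (n : nat) (W : gradedSpace K n).
Notation L := (weight n * W)%type.
Variables (dq : weight n) (k : seq L -> K) (q : seq L -> W) (p0 : nat).
Implicit Types (J s t : seq L).

Lemma coextend_cons (M : lmodType K) (f : seq L -> M) J x s :
  coextend dq k q f J (x :: s) =
  k (rcons J x) *: f (insertion dq q (rcons J x) :: s) +
  sg K (dq + deg J) x.1 *: coextend dq k q (fun t => f (x :: t)) J s +
  coextend dq k q f (rcons J x) s.
Proof. by []. Qed.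

Lemma linear_coextend (M N : lmodType K) (H : M -> N) (f : seq L -> M) J s :
  linear H -> H (coextend dq k q f J s) = coextend dq k q (fun t => H (f t)) J s.
Proof.
move=> lH; elim: s f J => [|x s IH] f J /=; first exact: linear_zero.
by rewrite !(linear_add _ _ lH) !(linear_scale _ _ lH) !IH.
Qed.

Hypothesis k_size : forall J, k J != 0 -> size J = p0.
Hypothesis q_homog : forall J, all_homog J -> k J != 0 -> homog (dq + deg J) (q J).

(** Every word produced has the expected degree and length: p0 letters are replaced
    by one. *)
Lemma coextend_ind (M : lmodType K) (P : M -> Prop) (f : seq L -> M) J s :
  P 0 -> (forall c x y, P x -> P y -> P (c *: x + y)) ->
  all_homog J -> all_homog s ->
  (forall t, all_homog t -> deg t = dq + deg J + deg s ->
     (size t + p0)%N = (size J + size s).+1 -> P (f t)) ->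
  P (coextend dq k q f J s).
Proof.
move=> P0 Plin; elim: s f J => //= x s IH f J hJ /all_homog_cons[hx hs] Pf.
have hJx : all_homog (rcons J x) by apply/all_homog_rcons.
have PJ : P (sg K (dq + deg J) x.1 *: coextend dq k q (fun t => f (x :: t)) J s +
             coextend dq k q f (rcons J x) s).
  apply: Plin; apply: IH => // t ht dt st; apply: Pf => //.
  - by apply/all_homog_cons.
  - by rewrite !deg_cons dt addrCA.
  - by rewrite /= addSn st addnS.
  - by rewrite dt deg_rcons deg_cons !addrA.
  - by rewrite st size_rcons addSnnS.
rewrite -addrA; have [->|k0] := eqVneq (k (rcons J x)) 0.
  by rewrite scale0r add0r.
apply: Plin => //; apply: Pf.
- by apply/all_homog_cons; split=> //; apply: q_homog.
- by rewrite !deg_cons /= deg_rcons !addrA.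
- by rewrite /= -(k_size k0) size_rcons; lia.
Qed.

Lemma coextend_eq (M : lmodType K) (f g : seq L -> M) J s :
  all_homog J -> all_homog s ->
  (forall t, all_homog t -> deg t = dq + deg J + deg s ->
     (size t + p0)%N = (size J + size s).+1 -> f t = g t) ->
  coextend dq k q f J s = coextend dq k q g J s.
Proof.
move=> hJ hs fg; apply/subr0_eq; rewrite addrC -scaleN1r -coextend_lin.
apply: (@coextend_ind _ (fun x => x = 0)) => // [c x y -> ->|t ht dt st].
  by rewrite scaler0 addr0.
by rewrite fg // scaleN1r addNr.
Qed.

Hypothesis k_degrees : forall s t d x y, k (s ++ (d, x) :: t) = k (s ++ (d, y) :: t).
Hypothesis q_multilin : forall s t d c x y, k (s ++ (d, x) :: t) != 0 ->
  q (s ++ (d, c *: x + y) :: t) = c *: q (s ++ (d, x) :: t) + q (s ++ (d, y) :: t).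

Lemma insertion_multilin (M : lmodType K) (f : seq L -> M) u : multilin f ->
  multilin (fun J => k J *: f (insertion dq q J :: u)).
Proof.
move=> mf s t d c x y; rewrite (k_degrees s t d _ x) (k_degrees s t d y x).
have [->|k0] := eqVneq (k (s ++ (d, x) :: t)) 0.
  by rewrite !scale0r scaler0 addr0.
rewrite /insertion q_multilin // !deg_cat !deg_cons /= (multilin_head _ _ mf).
by rewrite scalerDr !scalerA mulrC.
Qed.

Lemma coextend_multilin_acc (M : lmodType K) (f : seq L -> M) s : multilin f ->
  multilin (fun J => coextend dq k q f J s).
Proof.
elim: s f => [|z s IH] f mf a b d c x y /=; first by rewrite scaler0 addr0.
rewrite !rcons_cat /= (insertion_multilin s mf) (IH f mf).
rewrite (IH (fun t => f (z :: t))); last exact: multilin_cons.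
rewrite !deg_cat !deg_cons !scalerDr [X in X + _]addrACA [LHS]addrACA.
by rewrite !scalerA ![_ * c]mulrC.
Qed.

Lemma coextend_multilin (M : lmodType K) (f : seq L -> M) J : multilin f ->
  multilin (coextend dq k q f J).
Proof.
move=> mf s t d c x y; elim: s f mf J => [|z s IH] f mf J /=.
  rewrite -!cats1 (insertion_multilin _ mf) (coextend_multilin_acc _ mf).
  rewrite (_ : (fun t => f ((d, c *: x + y) :: t)) =
    (fun t => c *: f ((d, x) :: t) + f ((d, y) :: t))); last first.
    by apply/funext => u; apply: multilin_head.
  rewrite coextend_lin !scalerDr [X in X + _]addrACA [LHS]addrACA.
  by rewrite !scalerA ![_ * c]mulrC.
rewrite (IH f mf) (IH (fun t => f (z :: t))); last exact: multilin_cons.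
rewrite (multilin_cons (insertion dq q (rcons J z)) mf).
rewrite !scalerDr [X in X + _]addrACA [LHS]addrACA.
by rewrite !scalerA ![_ * c]mulrC.
Qed.

(** The co-Leibniz rule holds on homogeneous words by [coextend_unshuffle], and then
    everywhere by linearity. *)
Lemma extension_coderivation : exists2 Q : T W -> T W, coderivation dq Q &
  forall u, all_homog u -> Q (dword u) = coextend dq k q (@dword K n W) [::] u.
Proof.
have [Q lQ QE] := T_lift (coextend_multilin [::] (@dword_multilin K n W)) erefl.
have hnil : all_homog ([::] : seq L) by move=> l; rewrite in_nil.
exists Q => //; split=> // [d|].
  apply: homogT_ind => [|c x y hx hy|u hu <-].
  - by rewrite linear_zero //; apply: lspan0.
  - by rewrite lQ; apply: homogT_lin.
  rewrite QE //; apply: coextend_ind => // [|c x y|t ht dt _]; first exact: lspan0.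
    exact: homogT_lin.
  by move: (homogT_dword ht); rewrite dt deg_nil addr0 addrC.
have [lD DE] := coproductP W.
apply: T_eq => [c x y|c x y|u hu].
- by rewrite lQ lD.
- by rewrite lD [LHS](leibniz_linear _ lQ).
rewrite -/(leibniz _ _ _) leibniz_unshuffle // QE // linear_coextend //.
rewrite (coextend_eq (g := unshuffle (@dpair K n W))) // => [|t ht _ _]; last exact: DE.
rewrite coextend_unshuffle; apply: unshuffle_eq => // I J hI hJ _ _.
rewrite !QE // deg_nil addr0 (linear_coextend _ _ _ (tpair_linl _)).
by rewrite (linear_coextend _ _ _ (tpair_linr _)).
Qed.

(** The next lemmas list the terms according to the number of letters that are not
    arguments of q.  There are none if too few letters are available, or if the
    arguments are already complete. *)
Lemma coextend_small (M : lmodType K) (f : seq L -> M) J s :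
  (size J + size s < p0)%N -> coextend dq k q f J s = 0.
Proof.
elim: s f J => //= x s IH f J sJ.
rewrite !IH ?size_rcons ?addSnnS //; last by rewrite -addnS ltnW // addnS.
have [->|/k_size] := eqVneq (k (rcons J x)) 0; first by rewrite scale0r scaler0 !addr0.
by rewrite size_rcons => sE; move: sJ; rewrite addnS -addSn sE ltnNge leq_addr.
Qed.

Lemma coextend_full (M : lmodType K) (f : seq L -> M) J s :
  (p0 <= size J)%N -> coextend dq k q f J s = 0.
Proof.
elim: s f J => //= x s IH f J sJ.
rewrite !IH ?size_rcons //; last exact: leqW.
have [->|/k_size] := eqVneq (k (rcons J x)) 0; first by rewrite scale0r scaler0 !addr0.
by rewrite size_rcons => sE; move: sJ; rewrite -sE ltnn.
Qed.

Lemma coextend_exact (M : lmodType K) (f : seq L -> M) J s : s != [::] ->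
  (size J + size s)%N = p0 ->
  coextend dq k q f J s = k (J ++ s) *: f [:: insertion dq q (J ++ s)].
Proof.
elim: s f J => // x [|y s] IH f J _ sJ.
  by rewrite /= cats1 scaler0 !addr0.
have k0 : k (rcons J x) = 0.
  apply/eqP; apply: contraTT isT => /k_size; rewrite size_rcons => sE.
  by move: sJ; rewrite -sE /=; lia.
rewrite -cat_rcons -IH ?size_rcons ?addSnnS //.
have small : coextend dq k q (fun t => f (x :: t)) J (y :: s) = 0.
  by apply: coextend_small; rewrite -sJ /=; lia.
by rewrite coextend_cons k0 small scale0r scaler0 !add0r.
Qed.

(** One letter is left over: the last one, or one that moves to the front. *)
Lemma coextend_surplus (M : lmodType K) (f : seq L -> M) J u z (l0 : L) : u != [::] ->
  (size J + size u)%N = p0 ->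
  coextend dq k q f J (rcons u z) = k (J ++ u) *: f [:: insertion dq q (J ++ u); z] +
    \sum_(i < size u)
      (sg K (dq + deg (J ++ take i u)) (nth l0 u i).1 *
       k (J ++ take i u ++ rcons (drop i.+1 u) z)) *:
      f [:: nth l0 u i; insertion dq q (J ++ take i u ++ rcons (drop i.+1 u) z)].
Proof.
elim: u J f => // x u IH J f _ sJ.
rewrite rcons_cons coextend_cons big_ord_recl take0 cats0.
have -> : coextend dq k q (fun t => f (x :: t)) J (rcons u z) =
    k (J ++ rcons u z) *: f [:: x; insertion dq q (J ++ rcons u z)].
  by rewrite coextend_exact // ?size_rcons //; case: (u).
rewrite scalerA [nth l0 _ _]/= [drop _ _]/= drop0 cat0s [RHS]addrCA.
rewrite [LHS]addrAC [LHS]addrC; congr (_ + _).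
under eq_bigr => i _.
  rewrite [take _ _]/= [nth l0 _ _]/= [drop _ _]/= -!cat_rcons.
  over.
have [u0|u0] := eqVneq u [::].
  rewrite u0 big_ord0 addr0 cats1 coextend_full ?addr0 // size_rcons -sJ u0 /=; lia.
rewrite [k (rcons J x)](_ : _ = 0) ?scale0r ?add0r.
  by rewrite IH ?size_rcons ?addSnnS // -cat_rcons.
apply/eqP; apply: contraTT isT => /k_size; rewrite size_rcons => sE.
by case: (u) sJ u0 => [|? ?] /= sJ // _; move: sE; rewrite -sJ; lia.
Qed.

Lemma coextend_pair_head (M : lmodType K) (f : seq L -> M) x s (l0 : L) : p0 = 2%N ->
  coextend dq k q f [:: x] s = \sum_(i < size s)
    (sg K (dq + x.1) (deg (take i s)) * k [:: x; nth l0 s i]) *: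
    f (take i s ++ insertion dq q [:: x; nth l0 s i] :: drop i.+1 s).
Proof.
move=> p2; elim: s f => [|y s IH] f; first by rewrite big_ord0.
rewrite coextend_cons big_ord_recl take0 deg_nil sg0r mul1r /= drop0 -addrA; congr (_ + _).
rewrite [coextend _ _ _ f _ _]coextend_full ?p2 // addr0 IH scaler_sumr; apply: eq_bigr => i _.
by rewrite scalerA !deg_cons deg_nil addr0 sgDr mulrA.
Qed.

(** With two arguments, the first one is the letter at position j; the letters before
    it are passed by q alone. *)
Lemma coextend_pair (M : lmodType K) (f : seq L -> M) s (l0 : L) : p0 = 2%N ->
  coextend dq k q f [::] s = \sum_(j < size s) sg K dq (deg (take j s)) *:
    coextend dq k q (fun t => f (take j s ++ t)) [:: nth l0 s j] (drop j.+1 s).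
Proof.
move=> p2; elim: s f => [|y s IH] f; first by rewrite big_ord0.
rewrite coextend_cons big_ord_recl take0 deg_nil addr0 sg0r scale1r /= drop0.
rewrite [k _](_ : _ = 0) ?scale0r ?add0r.
  rewrite addrC IH scaler_sumr; congr (_ + _); apply: eq_bigr => i _.
  by rewrite scalerA deg_cons sgDr.
by apply/eqP; apply: contraTT isT => /k_size /=; rewrite p2.
Qed.
End Extension.

(** * The coderivation of a multilinear map *)

Section StemCoderivation.
Variables (K : fieldType) (n : nat) (V : gradedSpace K n).
Hypothesis n_gt0 : (0 < n)%N.
Notation W := (down V).
Notation L := (weight n * W)%type.
Notation xgetPex := classical_sets.xgetPex.

Lemma dot_e1 : dot (e1 n) (e1 n) = 1.
Proof.
rewrite /dot; case: n n_gt0 => // n' _.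
rewrite big_ord_recl big1 ?addr0 => [|i _]; first by rewrite !mxE.
by rewrite !mxE mulr0.
Qed.

Lemma sg_e1 : sg K (e1 n) (e1 n) = -1.
Proof. by rewrite /sg dot_e1 expr1z. Qed.

Definition up_degree (l : L) : weight n := l.1 + e1 n.

(** In terms of the degrees in V, the sign of the corestriction of phi(A) loses its
    prefactor (see [up_sign_shift]). *)
Definition up_sgn (J : seq L) : K := up_sign K (map up_degree J).

(** Each letter shifts its exponent by the number of letters that follow it, and
    these numbers add up to the exponent of the prefactor. *)
Lemma up_sign_shift (J : seq L) :
  (-1) ^+ ((size J).-1 * size J)./2 * up_sign K (map fst J) = up_sgn J.
Proof.
elim: J => [|x J IH]; first by rewrite mulr1.
rewrite /up_sgn /= -/(up_sgn J) -IH !size_map /up_degree sgDr !sgMnl sg_e1.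
have -> : ((size J * (size J).+1)./2 = size J + ((size J).-1 * size J)./2)%N.
  rewrite mulnC -[X in (_ * X)%N]/(size J).+1.-1 -bin2.
  by rewrite [(_.-1 * _)%N]mulnC -bin2 binS bin1 addnC.
by rewrite exprD; ring.
Qed.

Lemma up_sign_sq d : up_sign K (n:=n) d * up_sign K d = 1.
Proof. by elim: d => [|x d IH] /=; rewrite ?mulr1 // mulrACA sg_sq IH mulr1. Qed.

Section Map.
Variables (dA : weight n) (a : nat) (A : a.+1.-tuple V -> V).
Hypothesis A_cochain : cochain dA A.

Definition corestr_sign (J : seq L) : K := if size J == a.+1 then up_sgn J else 0.
Definition corestr (J : seq L) : W := eval_seq A (letters J : seq V).

Lemma eval_seq_tuple (t : a.+1.-tuple V) : eval_seq A t = A t.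
Proof.
rewrite /eval_seq; congr A; apply: eq_from_tnth => i.
by rewrite tnth_mktuple -tnth_nth.
Qed.

Lemma corestr_homog J : all_homog J -> corestr_sign J != 0 ->
  homog (dA + e1 n *+ a + deg J) (corestr J).
Proof.
rewrite /corestr_sign => hJ; case: (size _ =P _) => [sJ _|_]; last by rewrite eqxx.
have [d [w [hw JE]]] := dlettersP hJ sJ.
rewrite /homog /= /hom_down -JE /corestr letters_dletters (eval_seq_tuple w).
rewrite (_ : _ + e1 n = dA + \sum_(i < a.+1) tnth [tuple tnth d j + e1 n | j < a.+1] i).
  by apply: A_cochain.2 => i; rewrite tnth_mktuple; apply: hw.
rewrite deg_dletters [in RHS](eq_bigr (fun i => tnth d i + e1 n)); last first.
  by move=> i _; rewrite tnth_mktuple.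
rewrite big_split /= sumr_const card_ord mulrSr -!addrA; congr (_ + _).
by rewrite addrCA.
Qed.

Lemma eval_seq_multilin (s t : seq V) c x y : (size s + size t)%N = a ->
  eval_seq A (s ++ (c *: x + y) :: t) =
  c *: eval_seq A (s ++ x :: t) + eval_seq A (s ++ y :: t).
Proof.
move=> st; have sa : (size s < a.+1)%N by rewrite ltnS -st leq_addr.
pose t0 := [tuple nth 0 (s ++ x :: t) j | j < a.+1].
have E z : eval_seq A (s ++ z :: t) = A (set_tnth t0 (Ordinal sa) z).
  rewrite /eval_seq; congr A; apply: eq_from_tnth => i.
  rewrite !tnth_mktuple !nth_cat -val_eqE /=.
  case: ltngtP => // [lt|->]; last by rewrite subnn.
  by rewrite -[(i - size s)%N]prednK ?subn_gt0.
by rewrite !E A_cochain.1.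
Qed.

Lemma corestr_multilin s t d c (x y : W) : corestr_sign (s ++ (d, x) :: t) != 0 ->
  corestr (s ++ (d, c *: x + y) :: t) =
  c *: corestr (s ++ (d, x) :: t) + corestr (s ++ (d, y) :: t).
Proof.
rewrite /corestr_sign; case: (size _ =P _) => [sE _|_]; last by rewrite eqxx.
rewrite /corestr /letters !map_cat /=; apply: eval_seq_multilin.
by move: sE; rewrite size_cat /= addnS !size_map => -[].
Qed.

Lemma corestr_sign_degrees s t d (x y : W) :
  corestr_sign (s ++ (d, x) :: t) = corestr_sign (s ++ (d, y) :: t).
Proof. by rewrite /corestr_sign /up_sgn !size_cat !map_cat. Qed.

Lemma corestr_sign_size J : corestr_sign J != 0 -> size J = a.+1.
Proof. by rewrite /corestr_sign; case: (size _ =P _) => // _; rewrite eqxx. Qed.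

(** The explicit coderivation meets the specification of phi(A), which therefore has
    a solution, and phi(A) equals it by [coderivation_unique]. *)
Lemma phi_spec : let Q := phi dA A in
  [/\ coderivation (dA + e1 n *+ a) Q,
      forall u, all_homog u ->
        proj1T (Q (dword u)) = corestr_sign u *: corestr u
    & forall u, all_homog u -> Q (dword u) =
       coextend (dA + e1 n *+ a) corestr_sign corestr (@dword K n W) [::] u].
Proof.
have [lp p1 p0] := proj1TP W.
have [Q cQ QE] := extension_coderivation corestr_sign_size corestr_homog
  corestr_sign_degrees corestr_multilin.
have hnil : all_homog ([::] : seq L) by move=> l; rewrite in_nil.
pose P Q := [/\ coderivation (dA + e1 n *+ a) Q,
        forall (w : a.+1.-tuple (down V)) (d : a.+1.-tuple (weight n)),
          homogs d w ->
          proj1T (Q (word w)) =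
          ((-1) ^+ (a * a.+1)./2 * up_sign K d) *:
            to_down (A (map_tuple (@to_up K n V) w))
      & forall p (w : p.-tuple (down V)), p != a.+1 ->
          proj1T (Q (word w)) = 0].
have proj0 Q' u : P Q' -> all_homog u -> 
    proj1T (Q' (dword u)) = corestr_sign u *: corestr u.
  case=> _ Q1 Q2 hu; rewrite /corestr_sign; case: eqP => sE.
    have [d [w [hw <-]]] := dlettersP hu sE.
    rewrite dword_dletters (Q1 w d) // -up_sign_shift size_dletters degrees_dletters.
    congr (_ *: _); rewrite /corestr letters_dletters.
    rewrite (eval_seq_tuple w) /to_down; congr A; apply: val_inj.
    exact: map_id.
  by rewrite scale0r; apply: (Q2 _ (in_tuple (letters u))); rewrite size_map; apply/eqP.
have PQ : P Q.
  have lpQ : linear (fun x => proj1T (Q x) : W).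
    by move=> c x y; case: cQ => lQ _ _; rewrite lQ lp.
  split=> // [w d hw|p w pa].
    rewrite -(dword_dletters d) QE; last exact: all_homog_dletters.
    rewrite (coextend_exact _ _ corestr_sign_size) ?size_dletters //; last first.
      by rewrite -size_eq0 size_dletters.
    rewrite (linear_scale _ _ lp) [X in _ *: X]p1 cat0s.
    rewrite /corestr_sign size_dletters eqxx -up_sign_shift.
    rewrite size_dletters degrees_dletters; congr (_ *: _).
    rewrite /insertion [LHS]/= /corestr letters_dletters (eval_seq_tuple w).
    by rewrite /to_down; congr A; apply: val_inj; rewrite /= [RHS]map_id.
  apply: (@word_eq _ _ _ _ (fun x => proj1T (Q x)) (fun=> 0)) => // [c x y|u hu su].
    by rewrite scaler0 addr0.
  rewrite QE //.
  apply: (coextend_ind (P := fun x => proj1T x = 0 :> W)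
    corestr_sign_size corestr_homog) => //.
  - exact: linear_zero.
  - by move=> c x y xE yE; rewrite lp xE yE scaler0 addr0.
  move=> t _ _ st; apply: p0; rewrite size_map.
  apply: contraNneq pa => t1; move: st; rewrite t1 su size_tuple add0n add1n.
  by case=> ->.
have Pphi : P (phi dA A) by apply: xgetPex; exists Q.
split=> [|u hu|u hu]; [by case: Pphi | exact: proj0 |].
rewrite -QE //; apply: (coderivation_unique _ cQ); first by case: Pphi.
by move=> v hv; rewrite !proj0.
Qed.
End Map.

Lemma proj1T_homog d (x : T W) : homogT d x -> homog d (proj1T x : W).
Proof.
have [lp p1 p0] := proj1TP W.
apply: (homogT_ind (P := fun x => homog d (proj1T x : W))) => [|c {}x y hx hy|u hu <-].
- by rewrite linear_zero //; apply: homog0.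
- by rewrite lp; apply: homogP.
- have [s1|s1] := eqVneq (size u) 1%N; last first.
    by rewrite p0 ?size_map //; apply: homog0.
  case: u s1 hu => [|l [|? ?]] // _ /all_homog_cons[hl _].
  by rewrite deg_cons deg_nil addr0 p1.
Qed.

(** The multilinear map is the corestriction of Q with the sign removed.  It is first
    defined on homogeneous arguments, where the sign makes sense, and extended by
    [T_lift]. *)
Lemma phi_inv_spec (dC : weight n) c (Q : T W -> T W) :
  coderivation (dC + e1 n *+ c) Q ->
  (forall u, all_homog u -> size u != c.+1 -> proj1T (Q (dword u)) = 0) ->
  forall (v : c.+1.-tuple V) (d : c.+1.-tuple (weight n)),
    homogs (W := W) d v ->
    phi_inv dC Q v = up_sgn (dletters (W := W) d v) *:
      (proj1T (Q (word (v : seq W))) : V).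
Proof.
move=> cQ Q0; have [lp p1 p0] := proj1TP W; have [lQ hQ _] := cQ.
pose f (u : seq L) : W := up_sgn u *: proj1T (Q (dword u)).
have mf : multilin f.
  move=> s t d e x y; rewrite /f dword_multilin lQ lp scalerDr !scalerA mulrC.
  by rewrite /up_sgn !map_cat.
have [|p lp' pE] := T_lift mf.
  by rewrite /f /dword word_nil (linear_zero lQ) (linear_zero lp) scaler0.
pose C (v : c.+1.-tuple V) : V := p (word (v : seq W)).
have set_tnthE (t : c.+1.-tuple V) i x :
    set_tnth t i x = take i t ++ x :: drop i.+1 t :> seq V.
  apply: (@eq_from_nth _ 0) => [|j].
    rewrite size_tuple size_cat /= size_take size_drop size_tuple ltn_ord.
    by have := ltn_ord i; lia.
  rewrite size_tuple => jc; rewrite -[j]/(val (Ordinal jc)) -tnth_nth tnth_mktuple.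
  rewrite nth_cat size_take size_tuple ltn_ord -val_eqE /=.
  case: ltngtP => [ji|ji|->]; last by rewrite subnn.
    by rewrite (tnth_nth 0) /= nth_take.
  rewrite (tnth_nth 0) -[(j - i)%N]prednK ?subn_gt0 //= nth_drop.
  by congr nth; lia.
have Ccochain : cochain dC C.
  split=> [t i e x y|t d ht].
    by rewrite /C !set_tnthE (@word_multilinP K W) lp'.
  pose d' := [tuple tnth d i - e1 n | i < c.+1].
  have ht' : homogs (W := W) d' (t : c.+1.-tuple W).
    by move=> i; rewrite tnth_mktuple /homog /= /hom_down subrK.
  rewrite /C -(dword_dletters d') pE; last exact: all_homog_dletters.
  have := proj1T_homog (hQ _ _ (homogT_dword (all_homog_dletters ht'))).
  move=> /(homogP (up_sgn (dletters d' (t : c.+1.-tuple W)))) /(_ (homog0 W _)).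
  rewrite addr0 /f {1}/homog /= /hom_down deg_dletters.
  rewrite (eq_bigr (fun i => tnth d i - e1 n)); last first.
    by move=> i _; rewrite tnth_mktuple.
  rewrite sumrB sumr_const card_ord.
  set D := \sum_(i < _) _; set F := _ *: _; rewrite (_ : _ + e1 n = dC + D) //.
  rewrite mulrSr; move: (e1 n *+ c) (e1 n) D => E e D.
  by apply/rowP => j; rewrite !mxE; ring.
have phiC : phi dC C = Q.
  have [cC C0 _] := phi_spec Ccochain.
  apply/funext; apply: (coderivation_unique cC cQ) => u hu.
  rewrite C0 // /corestr_sign; case: (size u =P c.+1) => [su|/eqP su]; last first.
    by rewrite scale0r Q0.
  have [d [w [hw uE]]] := dlettersP hu su.
  rewrite -uE /corestr letters_dletters (eval_seq_tuple C w) /C.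
  rewrite -(dword_dletters d) pE; last exact: all_homog_dletters.
  by rewrite /f scalerA up_sign_sq scale1r.
pose P (C : c.+1.-tuple V -> V) := cochain dC C /\ phi dC C = Q.
have [C'cochain phiC'] : P (phi_inv dC Q) by apply: xgetPex; exists C.
move=> v d hv; have [_ C0 _] := phi_spec C'cochain.
have hu : all_homog (dletters (W := W) d v) by apply: all_homog_dletters.
have := C0 _ hu; rewrite phiC' dword_dletters /corestr_sign size_dletters eqxx => ->.
rewrite scalerA up_sign_sq scale1r /corestr letters_dletters.
by rewrite eval_seq_tuple.
Qed.
End StemCoderivation.

(** * The bracket of a binary and a multilinear map *)

Section StemBracket.
Variables (K : fieldType) (n : nat) (V : gradedSpace K n).
Hypothesis n_gt0 : (0 < n)%N.
Notation W := (down V).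
Notation L := (weight n * W)%type.
Variables (br : V -> V -> V) (dB : weight n) (b : nat) (B : b.+1.-tuple V -> V).
Hypothesis br_cochain : cochain 0 (bilin br).
Hypothesis B_cochain : cochain dB B.

Notation q1 := (0 + e1 n *+ 1).
Notation qB := (dB + e1 n *+ b).
Notation cobr := (corestr (bilin br)).
Notation coB := (corestr B).
Notation sgbr := (@corestr_sign K n V 1).
Notation sgB := (@corestr_sign K n V b).

(** The corestrictions of the two composites of phi(br) and phi(B) (see
    [proj_br_after_B] and [proj_B_after_br]). *)
Definition br_after_B (u : seq L) : W :=
  coextend qB sgB coB (fun t => sgbr t *: cobr t) [::] u.
Definition B_after_br (u : seq L) : W :=
  coextend q1 sgbr cobr (fun t => sgB t *: coB t) [::] u.

Let hnil : all_homog ([::] : seq L).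
Proof. by move=> l; rewrite in_nil. Qed.

Lemma proj_br_after_B u : all_homog u ->
  proj1T (phi 0 (bilin br) (phi dB B (dword u))) = br_after_B u.
Proof.
move=> hu; have [_ _ ->] // := phi_spec n_gt0 B_cochain.
have [[l1 _ _] p1 _] := phi_spec n_gt0 br_cochain; have [lp _ _] := proj1TP W.
rewrite (linear_coextend _ _ _ _ _ _ l1) (linear_coextend _ _ _ _ _ _ lp).
apply: (coextend_eq (@corestr_sign_size _ _ _ _) (corestr_homog B_cochain)) => //.
by move=> t ht _ _; apply: p1.
Qed.

Lemma proj_B_after_br u : all_homog u ->
  proj1T (phi dB B (phi 0 (bilin br) (dword u))) = B_after_br u.
Proof.
move=> hu; have [_ _ ->] // := phi_spec n_gt0 br_cochain.
have [[l1 _ _] p1 _] := phi_spec n_gt0 B_cochain; have [lp _ _] := proj1TP W.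
rewrite (linear_coextend _ _ _ _ _ _ l1) (linear_coextend _ _ _ _ _ _ lp).
apply: (coextend_eq (@corestr_sign_size _ _ _ _) (corestr_homog br_cochain)) => //.
by move=> t ht _ _; apply: p1.
Qed.

Lemma br_after_B0 u : all_homog u -> size u != b.+2 -> br_after_B u = 0.
Proof.
move=> hu su; rewrite -(coextend_zero qB sgB coB W [::] u).
apply: (coextend_eq (@corestr_sign_size _ _ _ _) (corestr_homog B_cochain)) => // t _ _ st.
rewrite /corestr_sign; case: eqP => [s2|]; rewrite ?scale0r //.
by move: su st; rewrite s2 /=; lia.
Qed.

Lemma B_after_br0 u : all_homog u -> size u != b.+2 -> B_after_br u = 0.
Proof.
move=> hu su; rewrite -(coextend_zero q1 sgbr cobr W [::] u).
apply: (coextend_eq (@corestr_sign_size _ _ _ _) (corestr_homog br_cochain)) => // t _ _ st.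
rewrite /corestr_sign; case: eqP => [s2|]; rewrite ?scale0r //.
by move: su st; rewrite s2 /=; lia.
Qed.

Lemma stem_bracketE (v : b.+2.-tuple V) (d : b.+2.-tuple (weight n)) :
  homogs (W := W) d v -> let u := dletters (W := W) d v in
  stem_bracket 0 (bilin br) dB B v =
    up_sgn u *: (B_after_br u - sg K (e1 n) qB *: br_after_B u) :> V.
Proof.
move=> hv u.
have [c1 _ _] := phi_spec n_gt0 br_cochain.
have [cB _ _] := phi_spec n_gt0 B_cochain.
have cc := commutator_coderivation c1 cB.
have wE : q1 + qB = (0 + dB) + e1 n *+ (1 + b).
  by rewrite mulrnDr addrACA.
rewrite wE in cc; have [lp _ _] := proj1TP W.
have projE w : all_homog w -> proj1T (commutator q1 (phi 0 (bilin br)) qB (phi dB B) (dword w)) =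
    br_after_B w - sg K q1 qB *: B_after_br w.
  move=> hw; rewrite /commutator (linear_sub lp) (linear_scale _ _ lp).
  by rewrite proj_br_after_B // proj_B_after_br.
have hu : all_homog u by apply: all_homog_dletters.
rewrite /stem_bracket (phi_inv_spec n_gt0 cc _ hv); last first.
  move=> w hw sw; rewrite projE // br_after_B0 // B_after_br0 //.
  by rewrite scaler0 subrr.
rewrite -[word (v : seq W)](dword_dletters d) projE // -/u.
rewrite add0r mulr1n [e1 n *+ b + dB]addrC scalerA mulrC -scalerA; congr (_ *: _).
by rewrite scalerBr !scaleNr scalerA sg_sq scale1r opprK [LHS]addrC.
Qed.
End StemBracket.

(** * Comparison of signs

    The signs are first expressed by the degrees in V and by e1, using the
    bilinearity of the exponents, and then reduced to parities. *)

Section BracketSigns.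
Variables (K : fieldType) (n : nat) (V : gradedSpace K n).
Hypothesis n_gt0 : (0 < n)%N.
Notation W := (down V).
Notation L := (weight n * W)%type.
Implicit Types (p r t : seq L) (x y z : L) (a c : weight n).

Lemma sg_e1_sign : sg K (e1 n) (e1 n) = (-1) ^+ true.
Proof. exact: sg_e1. Qed.

Definition up_deg p : weight n := \sum_(y <- map (@up_degree K n V) p) y.

Lemma up_deg_cat p r : up_deg (p ++ r) = up_deg p + up_deg r.
Proof. by rewrite /up_deg map_cat big_cat. Qed.

Lemma up_deg_cons x p : up_deg (x :: p) = up_degree x + up_deg p.
Proof. by rewrite /up_deg /= big_cons. Qed.

Lemma deg_up p : deg p = up_deg p - e1 n *+ size p.
Proof.
elim: p => [|x p IH]; first by rewrite deg_nil /up_deg big_nil mulr0n subrr.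
rewrite deg_cons up_deg_cons IH /up_degree [size _]/= mulrS opprD.
by rewrite [RHS]addrACA addrK.
Qed.

Lemma up_sgn_cons x p : up_sgn (x :: p) = sg K (e1 n) (up_degree x) ^+ size p * up_sgn p.
Proof. by rewrite /up_sgn /= size_map sgMnl. Qed.

Lemma up_sgn_nil : up_sgn ([::] : seq L) = 1. Proof. by []. Qed.

Lemma up_sgn_bool p : exists e : bool, up_sgn p = (-1) ^+ e.
Proof.
elim: p => [|x p [e IH]]; first by exists false.
exists (odd (sg_odd (e1 n) (up_degree x) * size p + e)).
by rewrite up_sgn_cons IH sg_oddE -exprM -exprD signr_odd.
Qed.

Lemma up_sgn_cat p r :
  up_sgn (p ++ r) = sg K (e1 n) (up_deg p) ^+ size r * up_sgn p * up_sgn r.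
Proof.
elim: p => [|x p IH].
  by rewrite /up_deg big_nil sg0r expr1n !mul1r.
rewrite cat_cons !up_sgn_cons IH up_deg_cons size_cat sgDr exprMn exprD; ring.
Qed.

Variables (dB : weight n) (b : nat).
Notation q1 := (0 + e1 n *+ 1).
Notation qB := (dB + e1 n *+ b).
Notation s := (sg K (e1 n) qB).

(** The first sum: the letter z comes last and l stands for the value of B on p. *)
Lemma sign_last p z l : size p = b.+1 -> l.1 = qB + deg p ->
  s * up_sgn (rcons p z) * up_sgn p * up_sgn [:: l; z] = (-1) ^+ b.
Proof.
move=> sp le; have lE : up_degree l = dB + up_deg p.
  rewrite /up_degree le deg_up sp mulrSr; move: (e1 n *+ b) (e1 n) => E e.
  by apply/rowP => j; rewrite !mxE; ring.
rewrite -cats1 up_sgn_cat !up_sgn_cons lE [size _]/=.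
rewrite up_sgn_nil !sgDr !sgMnr sg_e1 // !expr1 expr0 !mulr1.
have [e ->] := up_sgn_bool p; rewrite !sg_oddE.
rewrite -?exprM -!exprD -[LHS]signr_odd -[RHS]signr_odd; congr ((-1) ^+ (_ : bool)).
rewrite !(oddD, oddM, oddb) /=.
by case: (sg_odd (e1 n) dB); case: (sg_odd (e1 n) (up_deg p)); case: e; case: (odd b).
Qed.

(** The second sum: the letter x of the word p ++ x :: r moves in front of the value
    l of B on p ++ r. *)
Lemma sign_middle p x r l : (size p + size r)%N = b.+1 ->
  s * up_sgn (p ++ x :: r) * (sg K (qB + deg p) x.1 * up_sgn (p ++ r)) *
    up_sgn [:: x; l] =
  (-1) ^+ size p * sg K (dB + up_deg p) (up_degree x).
Proof.
move=> sp; have xE : x.1 = up_degree x - e1 n by rewrite /up_degree addrK.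
have bE : odd b = ~~ odd (size p + size r) by rewrite sp /= negbK.
rewrite !up_sgn_cat !up_sgn_cons up_sgn_nil deg_up [size (x :: r)]/= [size _]/= xE.
move: (up_degree x) => X.
rewrite !(sgDr, sgDl, sgNr, sgNl, sgMnl, sgMnr) !sg_e1_sign // !exprMn.
rewrite (sgC K dB (e1 n)) (sgC K (up_deg p) (e1 n)).
have [e ->] := up_sgn_bool p; have [e' ->] := up_sgn_bool r; rewrite !sg_oddE.
rewrite !mulr1 -?exprM -!exprD -[LHS]signr_odd -[RHS]signr_odd; congr ((-1) ^+ (_ : bool)).
rewrite !(oddD, oddM, oddS, oddb, bE) /=.
case: (sg_odd (e1 n) dB); case: (sg_odd (e1 n) (up_deg p)); case: (sg_odd (e1 n) X);
  case: (sg_odd dB X); case: (sg_odd (up_deg p) X); case: e; case: e';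
  by case: (odd (size p)); case: (odd (size r)).
Qed.

(** The third sum: x and y are replaced by the letter l of their bracket, at the place
    of y. *)
Lemma sign_bracket p x r y t l :
  l.1 = q1 + deg [:: x; y] ->
  up_sgn (p ++ x :: r ++ y :: t) *
    (sg K q1 (deg p) * (sg K (q1 + x.1) (deg r) * up_sgn [:: x; y])) *
    up_sgn (p ++ r ++ l :: t) =
  (-1) ^+ size p * sg K (up_degree x) (up_deg r).
Proof.
move=> le; have lE : up_degree l = up_degree x + up_degree y.
  rewrite /up_degree le !deg_cons deg_nil; move: (e1 n) => e.
  by apply/rowP => j; rewrite !mxE; ring.
have xE : x.1 = up_degree x - e1 n by rewrite /up_degree addrK.
rewrite !(up_sgn_cat, up_sgn_cons, up_sgn_nil, up_deg_cat, up_deg_cons).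
rewrite !deg_up [size (x :: _)]/= [size (l :: _)]/= !size_cat [size (y :: _)]/= xE lE.
move: (up_degree x) (up_degree y) => X Y.
rewrite !(sgDr, sgDl, sgNr, sgNl, sgMnl, sgMnr) !sg_e1_sign // !sg0l !exprMn.
rewrite (sgC K _ (e1 n)).
have [e ->] := up_sgn_bool p; have [e' ->] := up_sgn_bool r.
have [e'' ->] := up_sgn_bool t; rewrite !sg_oddE.
rewrite !expr1n ?expr1 ?mulr1 !mul1r -?exprM -!exprD.
rewrite -[LHS]signr_odd -[RHS]signr_odd; congr ((-1) ^+ (_ : bool)).
rewrite !(oddD, oddM, oddS, oddb) /=.
case: (sg_odd (e1 n) X); case: (sg_odd (e1 n) Y); case: (sg_odd (e1 n) (up_deg p));
  case: (sg_odd (e1 n) (up_deg r)); case: (sg_odd X (up_deg r)); case: e; case: e';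
  by case: e''; case: (odd (size p)); case: (odd (size r)); case: (odd (size t)).
Qed.
End BracketSigns.

(** * The two halves of the commutator *)

Section Expansions.
Variables (K : fieldType) (n : nat) (V : gradedSpace K n).
Hypothesis n_gt0 : (0 < n)%N.
Notation W := (down V).
Notation L := (weight n * W)%type.
Variables (br : V -> V -> V) (dB : weight n) (b : nat) (B : b.+1.-tuple V -> V).
Variable l0 : L.
Notation q1 := (0 + e1 n *+ 1).
Notation qB := (dB + e1 n *+ b).
Notation s := (sg K (e1 n) qB).

Let corestr_br (x y : L) :
  @corestr_sign K n V 1 [:: x; y] *: corestr (bilin br) [:: x; y] =
  up_sgn [:: x; y] *: (br x.2 y.2 : W).
Proof. by rewrite /corestr_sign /= /corestr /eval_seq /bilin !tnth_mktuple. Qed.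

(** B takes all letters of the word but one ([coextend_surplus]). *)
Lemma br_after_B_expand (p : seq L) z : size p = b.+1 ->
  up_sgn (rcons p z) *: (s *: br_after_B br dB B (rcons p z)) =
  (-1) ^+ b *: (br (eval_seq B (letters p)) z.2 : W) +
  \sum_(i < b.+1)
    ((-1) ^+ i * sg K (dB + up_deg (take i p)) (up_degree (nth l0 p i))) *:
    (br (nth l0 p i).2
       (eval_seq B (letters (take i p ++ rcons (drop i.+1 p) z))) : W).
Proof.
move=> sp; rewrite /br_after_B (coextend_surplus _ _ (@corestr_sign_size _ _ _ _) _ _ l0) //;
  last by rewrite -size_eq0 sp.
rewrite sp cat0s !scalerDr; congr (_ + _).
  rewrite corestr_br {1}/corestr_sign sp eqxx !scalerA.
  rewrite -(@sign_last _ _ _ n_gt0 dB _ _ z (insertion qB (corestr B) p) sp erefl).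
  by congr (_ *: _); ring.
rewrite !scaler_sumr; apply: eq_bigr => i _.
have ip : (i < size p)%N by rewrite sp.
rewrite !cat0s corestr_br /corestr_sign size_cat size_rcons size_take ip size_drop.
rewrite (_ : (_ == _) = true); last by rewrite sp; apply/eqP; have := ltn_ord i; lia.
rewrite !scalerA; congr (_ *: _).
rewrite -[X in (-1) ^+ X](size_takel (ltnW ip)).
rewrite -(@sign_middle _ _ _ n_gt0 dB b _ _ (rcons (drop i.+1 p) z)
  (insertion qB (corestr B) (take i p ++ rcons (drop i.+1 p) z))).
  have -> : rcons p z = take i p ++ nth l0 p i :: rcons (drop i.+1 p) z.
    by rewrite -rcons_cons -drop_nth // -rcons_cat cat_take_drop.
  by ring.
by rewrite size_rcons size_take ip size_drop sp; have := ltn_ord i; lia.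
Qed.

(** The arguments of br are the letters at the positions j and i + j + 1. *)
Lemma B_after_br_expand (u : seq L) : size u = b.+2 ->
  up_sgn u *: B_after_br br B u =
  \sum_(j < b.+2) \sum_(i < b.+1 - j)
    ((-1) ^+ j * sg K (up_degree (nth l0 u j)) (up_deg (take i (drop j.+1 u)))) *:
    (eval_seq B (letters (take j u ++ take i (drop j.+1 u)) ++
       br (nth l0 u j).2 (nth l0 u (i + j).+1).2 :: letters (drop (i + j).+2 u)) : W).
Proof.
move=> su; rewrite /B_after_br (coextend_pair _ _ (@corestr_sign_size _ _ _ _) _ _ l0) //.
rewrite su scaler_sumr; apply: eq_bigr => j _.
have ju : (j < size u)%N by rewrite su.
rewrite (coextend_pair_head _ _ (@corestr_sign_size _ _ _ _) _ _ _ l0) // size_drop su subSS.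
rewrite !scaler_sumr; apply: eq_bigr => i _.
have iu : (i < size (drop j.+1 u))%N by rewrite size_drop su subSS.
have ij : ((i + j).+1 < size u)%N by move: iu; rewrite size_drop su; lia.
rewrite nth_drop addSn addnC drop_drop !addSn.
set x := nth l0 u j; set y := nth l0 u _.
set p := take j u; set r := take i _; set t := drop _ u.
have uE : u = p ++ x :: r ++ y :: t.
  rewrite -[LHS](cat_take_drop j) (drop_nth l0 ju); congr (_ ++ _ :: _).
  rewrite -[LHS](cat_take_drop i) (drop_nth l0 iu) nth_drop addSn addnC.
  by rewrite drop_drop addSn.
have sB : (size (p ++ r ++ insertion q1 (corestr (bilin br)) [:: x; y] :: t) == b.+1) = true.
  by apply/eqP; move: su; rewrite uE !(size_cat, size_rcons) /= !size_cat /=; lia.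
rewrite {1}/corestr_sign [size [:: x; y] == _]/= /corestr_sign sB !scalerA; congr (_ *: _).
  rewrite -[X in (-1) ^+ X](size_takel (ltnW ju)) -/p.
  by rewrite -(@sign_bracket _ _ _ n_gt0 p x r y t
     (insertion q1 (corestr (bilin br)) [:: x; y])) // -uE eqxx !mulrA.
rewrite /corestr /letters !map_cat /= catA; congr (eval_seq B (_ ++ _ :: _)).
  by rewrite /eval_seq /bilin !tnth_mktuple.
by rewrite /t addnS.
Qed.
End Expansions.

(** * The formula *)

Lemma sum_triangle (M : nmodType) N (G : nat -> nat -> M) :
  \sum_(j < N.+1) \sum_(i < N - j) G j i =
  \sum_(0 <= i < N) \sum_(0 <= j < i.+1) G j (i - j)%N.
Proof.
elim: N => [|N IH]; first by rewrite big_ord1 big_ord0 big_nil.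
rewrite big_ord_recr /= subnn [X in _ + X]big_ord0 addr0 big_nat_recr //= -IH.
rewrite big_mkord -big_split; apply: eq_bigr => j _ /=.
by rewrite subSn ?big_ord_recr // -ltnS.
Qed.

Lemma map_nth_index (T : Type) (x0 : T) s a c : (a + c <= size s)%N ->
  [seq nth x0 s k.-1 | k <- iota a.+1 c] = take c (drop a s).
Proof.
move=> ac; rewrite -(@map_nth_iota _ x0); last by lia.
by rewrite -[a.+1]addn1 addnC iotaDl -map_comp.
Qed.

Lemma map_nth_omit (T : Type) (x0 : T) s j c : (j < c)%N -> (c <= size s)%N ->
  [seq nth x0 s k.-1 | k <- index_iota 1 c.+1 & k != j.+1] =
  take j s ++ take (c - j.+1) (drop j.+1 s).
Proof.
move=> jc cs; have -> : index_iota 1 c.+1 = iota 1 j ++ j.+1 :: iota j.+2 (c - j.+1).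
  by rewrite /index_iota subn1 -[c.+1.-1](subnKC jc) addSnnS iotaD.
have keep a e : (a + e <= j.+1)%N || (j.+2 <= a)%N ->
    [seq k <- iota a e | k != j.+1] = iota a e.
  move=> ae; rewrite -[RHS]filter_predT; apply: eq_in_filter => k.
  by rewrite mem_iota /=; lia.
rewrite filter_cat /= eqxx /= !keep ?leqnn ?orbT ?add1n ?leqnn // map_cat.
by rewrite !map_nth_index ?drop0 //; lia.
Qed.

Theorem proposition10 (K : fieldType) (charK : [pchar K] =i pred0)
    (n : nat) (n_gt0 : (0 < n)%N) (V : gradedSpace K n)
    (br : V -> V -> V) (br_loday : loday br)
    (m : nat) (dB : weight n) (B : m.-tuple V -> V) (B_cochain : cochain dB B)
    (v : m.+1.-tuple V) (d : m.+1.-tuple (weight n)) (v_homog : homogs d v) :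
  let x k := nth 0 v k.-1 in
  let dx k := nth 0 d k.-1 in
  loday_diff br dB B v =
    (-1) ^+ m *: br (eval_seq B [seq x k | k <- index_iota 1 m.+1]) (x m.+1)
  - \sum_(1 <= i < m.+1)
      ((-1) ^+ i.-1 * sg K (dB + \sum_(1 <= k < i) dx k) (dx i)) *:
      br (x i) (eval_seq B [seq x k | k <- index_iota 1 m.+2 & k != i])
  + \sum_(1 <= i < m.+1) \sum_(1 <= j < i.+1)
      ((-1) ^+ j.+1 * sg K (dx j) (\sum_(j.+1 <= k < i.+1) dx k)) *:
      eval_seq B ([seq x k | k <- index_iota 1 i.+1 & k != j]
                  ++ br (x j) (x i.+1)
                  :: [seq x k | k <- index_iota i.+2 m.+2]).
Proof.
case: m => [|b] in B B_cochain v d v_homog * => x dx.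
  (* B is a vector, both sums are empty *)
  rewrite !big_geq // subr0 addr0 expr0 scale1r /= /eval_seq.
  congr (br (B _) _); first by apply: eq_from_tnth => -[].
  by rewrite /x /thead (tnth_nth 0).
have br_cochain := br_loday.1.
(* the degrees of the arguments as letters of down V *)
pose W := down V; pose d' := [tuple tnth d i - e1 n | i < b.+2].
have hv : homogs (W := W) d' v.
  by move=> i; rewrite tnth_mktuple /homog /= /hom_down subrK.
pose u := dletters (W := W) d' v; pose l0 : weight n * W := (0, 0).
have su : size u = b.+2 by apply: size_dletters.
have uv : map snd u = v by apply: letters_dletters.
have ud : map (@up_degree K n V) u = d.
  rewrite -map_comp -[RHS](map_tnth_enum d); apply: eq_map => i /=.
  by rewrite /up_degree tnth_mktuple subrK.
have nthv k : (k < b.+2)%N -> (nth l0 u k).2 = nth 0 v k.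
  by move=> kb; rewrite -uv (nth_map l0) ?su.
have nthd k : (k < b.+2)%N -> up_degree (nth l0 u k) = nth 0 d k.
  by move=> kb; rewrite -ud (nth_map l0) ?su.
have sumd a c : (a + c <= b.+2)%N ->
    \sum_(a.+1 <= k < (a + c).+1) dx k = up_deg (take c (drop a u)).
  move=> ac; rewrite /up_deg map_take map_drop ud -(@map_nth_index _ 0).
    by rewrite big_map /index_iota subSS addKn.
  by rewrite size_tuple.
rewrite [LHS](stem_bracketE n_gt0 br_cochain B_cochain hv) -/u scalerBr.
pose p := take b.+1 u; pose z := nth l0 u b.+1.
have sp : size p = b.+1 by rewrite size_takel // su.
have uE : u = rcons p z.
  by rewrite /p /z -(take_nth l0) ?su // -su take_size.
have brE := br_after_B_expand n_gt0 br dB B l0 z sp; rewrite -uE in brE.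
rewrite brE (B_after_br_expand n_gt0 br B l0 su) addrC opprD; congr (_ - _ + _).
- rewrite exprS mulN1r scaleNr /letters map_take uv nthv //.
  by rewrite -[index_iota 1 b.+2]/(iota 1 b.+1) map_nth_index ?size_tuple // drop0.
- rewrite big_add1 big_mkord; apply: eq_bigr => i _.
  have ib := ltn_ord i.
  rewrite [i.+1.-1]/= take_takel; last exact: ltnW.
  rewrite !nth_take // nthv ?nthd; try exact: ltnW.
  have := sumd 0%N i (leq_trans (ltnW ib) (leqnSn _)); rewrite drop0 add0n => ->.
  rewrite [in RHS]/x map_nth_omit ?size_tuple //; last exact: ltnW.
  rewrite [take (b.+2 - i.+1)%N _]take_oversize ?size_drop ?size_tuple //.
  congr (_ *: br _ (eval_seq B _)).
  have -> : rcons (drop i.+1 p) z = drop i.+1 u by rewrite uE drop_rcons // sp.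
  by rewrite /letters map_cat map_take map_drop uv.
rewrite (sum_triangle b.+1 (fun j i => ((-1) ^+ j *
        sg K (up_degree (nth l0 u j)) (up_deg (take i (drop j.+1 u)))) *:
       eval_seq B
         (letters (take j u ++ take i (drop j.+1 u)) ++
          br (nth l0 u j).2 (nth l0 u (i + j).+1).2
          :: letters (drop (i + j).+2 u)))).
rewrite big_add1; apply: eq_big_nat => i /andP[_ ib].
rewrite big_add1; apply: eq_big_nat => j /andP[_ ji].
have jb : (j < b.+2)%N by apply: leq_trans ji _; apply: ltnW.
rewrite subnK // nthd // !nthv // !exprS mulrA mulrNN mul1r mul1r.
have -> : \sum_(j.+2 <= k < i.+2) dx k = up_deg (take (i - j) (drop j.+1 u)).
  rewrite -sumd; last by lia.
  by rewrite addSn subnKC.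
rewrite [in RHS]/x map_nth_omit ?size_tuple ?subSS //; last by apply: ltnW.
rewrite /index_iota map_nth_index ?size_tuple; last by lia.
rewrite [take (b.+3 - _)%N _]take_oversize ?size_drop ?size_tuple //.
by rewrite /letters map_cat map_take map_take !map_drop uv.
Qed.
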